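(* Let $D=(V(D),E(D),w)$ be a weighted oriented graph with underlying simple graph $G$, and suppose $|V^{+}|\leq 1$, where $V^{+}=\{x\in V(D): w(x)>1\}$. Let $H=H(I(D)_{\langle 2\rangle})$ be the subgraph of $G$ whose edge ideal is $I(H)=I(D)_{\langle 2\rangle}$. Then the following statements are equivalent: (1) $I(D)$ is componentwise linear; (2) $I(D)$ is vertex splittable; (3) $I(D)$ has the linear quotient property; (4) $G$ and $H$ are both co-chordal.
   Context: A weighted oriented graph $D=(V(D),E(D),w)$ consists of a finite vertex set $V(D)=\{x_1,\dots,x_n\}$, a set $E(D)$ of directed edges $(x,y)$ (from $x$ towards $y$) between distinct vertices, obtained by orienting each edge of a simple graph in exactly one direction, and a weight function $w:V(D)\to\{1,2,3,\dots\}$. Its underlying simple graph $G$ has $V(G)=V(D)$ and $E(G)=\{\{x,y\}: (x,y)\in E(D)\text{ or }(y,x)\in E(D)\}$. Identifying vertices with variables of $R=\mathbb{K}[x_1,\dots,x_n]$, $\mathbb{K}$ a field, the edge ideal is $I(D)=(x_ix_j^{w(x_j)} : (x_i,x_j)\in E(D))\subseteq R$. If a vertex is a source (has no incoming edge), its weight does not affect $I(D)$ and by convention is taken to be $1$. The edge ideal of a simple graph $H$ is $I(H)=(x_ix_j:\{x_i,x_j\}\in E(H))$. For a homogeneous ideal $I\subseteq R$ and $d\ge 0$, $I_{\langle d\rangle}$ denotes the ideal generated by all homogeneous elements of degree $d$ in $I$. Thus $H$ is the (not necessarily induced) subgraph of $G$ whose edges are the $\{x_i,x_j\}$ with $x_ix_j\in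 I(D)$. A simple graph is chordal if it has no induced cycle of length greater than three, and co-chordal if its complement is chordal. $I$ is componentwise linear if for each $d\geq 0$ the ideal $I_{\langle d\rangle}$ has a $d$-linear resolution over $R$, i.e. is zero or satisfies $\operatorname{reg}(I_{\langle d\rangle})=d$ (Castelnuovo–Mumford regularity). For a monomial ideal $I$, $\mathcal{G}(I)$ denotes its minimal set of monomial generators. $I$ has the linear quotient property if there is an ordering $u_1<\cdots<u_m$ of $\mathcal{G}(I)$ such that the colon ideal $((u_1,\dots,u_{i-1}):u_i)$ is generated by a subset of the variables for $i=2,\dots,m$. A monomial ideal $I\subseteq\mathbb{K}[X]$ ($X$ a finite set of variables) is vertex splittable if it can be obtained by the following recursive procedure: (i) if $v$ is a monomial and $I=(v)$, or $I=(0)$, or $I$ is the whole ring, then $I$ is vertex splittable; (ii) if there are a variable $x\in X$ and vertex splittable ideals $I_1,I_2$ of $\mathbb{K}[X\setminus\{x\}]$ such that $I=xI_1+I_2$ (with $I_1, I_2$ viewed through their extensions to $\mathbb{K}[X]$), $I_2\subseteq I_1$, and $\mathcal{G}(I)$ is the disjoint union of $\mathcal{G}(xI_1)$ and $\mathcal{G}(I_2)$, then $I$ is vertex splittable. *)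

(* Defs.v *)
From HB Require Import structures.
From mathcomp Require Import all_boot all_order all_algebra.
From mathcomp Require Import zify.
From mathcomp Require Export mpoly.

Set Implicit Arguments.
Unset Strict Implicit.
Unset Printing Implicit Defensive.

Import GRing.Theory.

Local Open Scope ring_scope.

Record sgraph (T : finType) := SGraph {
  edge :> rel T;
  edge_sym : ssrbool.symmetric edge;
  edge_irr : irreflexive edge }.

Section Graphs.
Variable T : finType.
Implicit Types G H : sgraph T.

Definition compl_edge G : rel T := [rel x y | (x != y) && ~~ G x y].

Lemma compl_edge_sym G : ssrbool.symmetric (compl_edge G).
Proof. by move=> x y; rewrite /compl_edge /= eq_sym edge_sym. Qed.

Lemma compl_edge_irr G : irreflexive (compl_edge G).
Proof. by move=> x; rewrite /compl_edge /= eqxx. Qed.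

Definition complement G := SGraph (compl_edge_sym G) (compl_edge_irr G).

Definition induced_cycle G (c : seq T) : Prop :=
  [/\ uniq c, (2 < size c)%N
    & {in c &, forall x y, G x y = (y == next c x) || (x == next c y)}].

Definition chordal G : Prop :=
  forall c : seq T, induced_cycle G c -> (size c <= 3)%N.

Definition co_chordal G : Prop := chordal (complement G).

End Graphs.

Record wograph (n : nat) := WOGraph {
  arc : rel 'I_n;
  weight : 'I_n -> nat;
  arc_irr : irreflexive arc;
  arc_asym : forall x y, arc x y -> ~~ arc y x;
  weight_gt0 : forall x, (0 < weight x)%N;
  weight_source : forall x, (forall y, ~~ arc y x) -> weight x = 1%N }.

Section Underlying.
Variables (n : nat) (D : wograph n).

Definition underlying_edge : rel 'I_n := [rel x y | arc D x y || arc D y x].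

Lemma underlying_edge_sym : ssrbool.symmetric underlying_edge.
Proof. by move=> x y; rewrite /underlying_edge /= orbC. Qed.

Lemma underlying_edge_irr : irreflexive underlying_edge.
Proof. by move=> x; rewrite /underlying_edge /= arc_irr. Qed.

Definition underlying := SGraph underlying_edge_sym underlying_edge_irr.

End Underlying.

(* Ideals are Prop-valued sets of polynomials, compared extensionally. For a
   set X of variables, the polynomial ring K[X] is the subring [poly_in X] of
   K[x_1, ..., x_n]. *)
Section Ideals.
Variables (K : fieldType) (n : nat).
Local Notation R := {mpoly K[n]}.
Implicit Types (X : {set 'I_n}) (I J S : R -> Prop).

Definition eq_ideal I J : Prop := forall f, I f <-> J f.

Definition zero_ideal : R -> Prop := fun f => f = 0.

Definition mnm_in X (m : 'X_{1..n}) : bool :=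
  [forall i, (0 < m i)%N ==> (i \in X)].

Definition poly_in X : R -> Prop := fun p => all (mnm_in X) (msupp p).

(* the ideal of K[X] generated by S; also the extension to K[X] of an ideal S
   of K[Y], for Y \subset X *)
Definition span_in X S : R -> Prop := fun f =>
  exists2 s : seq (R * R),
    (forall c, c \in s -> poly_in X c.1 /\ S c.2) & f = \sum_(c <- s) c.1 * c.2.

Definition span S : R -> Prop := span_in [set: 'I_n] S.

Definition monomials (M : 'X_{1..n} -> Prop) : R -> Prop :=
  fun f => exists2 m, M m & f = 'X_[m].

Definition sum_ideal I J : R -> Prop :=
  fun f => exists g h, [/\ I g, J h & f = g + h].

Definition colon_ideal I (u : R) : R -> Prop := fun f => I (f * u).

(* I_<d> *)
Definition degree_component (d : nat) I : R -> Prop :=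
  span (fun f => I f /\ f \is d.-homog).

(* M is the set G(I) of minimal monomial generators of the ideal I of K[X] *)
Definition min_gens X I (M : 'X_{1..n} -> Prop) : Prop :=
  eq_ideal I (span_in X (monomials M)) /\
  forall M', (forall m, M' m -> M m) ->
    eq_ideal I (span_in X (monomials M')) -> forall m, M m -> M' m.

(* p is homogeneous of degree a - b; it is 0 if a < b *)
Definition homog_of_degree_diff (a b : nat) (p : R) : Prop :=
  if (b <= a)%N then is_true (p \is (a - b)%N.-homog) else p = 0.

(* Minimal graded free resolution
     ... -> F_2 -> F_1 -> F_0 -> I -> 0
   where F_i is free of rank [res_rank i], with a basis whose k-th element has
   degree [res_shift k]. Maps act on row vectors by right multiplication.
   Minimality, i.e. im (F_{i+1} -> F_i) \subset (x_1, ..., x_n) F_i, says that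
   the entries of the matrices have no constant term. *)
Record min_resolution I := MinResolution {
  res_rank : nat -> nat;
  res_shift : forall i, 'I_(res_rank i) -> nat;
  res_aug : 'cV[R]_(res_rank 0);
  res_diff : forall i, 'M[R]_(res_rank i.+1, res_rank i);
  res_aug_homog : forall k, res_aug k 0 \is (res_shift k).-homog;
  res_diff_homog : forall i k l,
    homog_of_degree_diff (res_shift k) (res_shift l) (res_diff i k l);
  res_aug_image : forall f,
    I f <-> exists u : 'rV[R]_(res_rank 0), f = (u *m res_aug) 0 0;
  res_aug_exact : forall u : 'rV[R]_(res_rank 0),
    u *m res_aug = 0 <-> exists v, u = v *m res_diff 0;
  res_diff_exact : forall i (u : 'rV[R]_(res_rank i.+1)),
    u *m res_diff i = 0 <-> exists v, u = v *m res_diff i.+1;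
  res_minimal : forall i k l, (res_diff i k l)@_0%MM = 0 }.

(* reg(I) = r, i.e. r = max {j - i | beta_{i,j}(I) != 0}. A minimal graded free
   resolution exists and is unique up to isomorphism, so its choice is
   immaterial. *)
Definition has_regularity I (r : nat) : Prop :=
  exists F : min_resolution I,
    (forall i (k : 'I_(res_rank F i)), (res_shift k <= r + i)%N) /\
    (exists i, exists k : 'I_(res_rank F i), res_shift k = (r + i)%N).

Definition linear_resolution (d : nat) I : Prop :=
  eq_ideal I zero_ideal \/ has_regularity I d.

Definition componentwise_linear I : Prop :=
  forall d, linear_resolution d (degree_component d I).

Definition linear_quotients I : Prop :=
  exists s : seq 'X_{1..n},
    [/\ uniq s,
        min_gens [set: 'I_n] I (fun m => m \in s)
      & forall i, (0 < i < size s)%N ->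
          exists X : {set 'I_n},
            eq_ideal
              (colon_ideal (span (monomials (fun m => m \in take i s)))
                           'X_[nth 0%MM s i])
              (span (fun f => exists2 x, x \in X & f = 'X_x))].

(* the ideal x I of K[X] *)
Definition mulX_ideal X (x : 'I_n) I : R -> Prop :=
  span_in X (fun f => exists2 g, I g & f = 'X_x * g).

(* [vertex_splittable_in X I]: I is a vertex splittable ideal of K[X] *)
Inductive vertex_splittable_in : {set 'I_n} -> (R -> Prop) -> Prop :=
| VSMonomial X I (v : 'X_{1..n}) :
    mnm_in X v -> eq_ideal I (span_in X (monomials (eq v))) ->
    vertex_splittable_in X I
| VSZero X I : eq_ideal I zero_ideal -> vertex_splittable_in X I
| VSFull X I : eq_ideal I (poly_in X) -> vertex_splittable_in X I
| VSSplit X I (x : 'I_n) I1 I2 (M1 M2 : 'X_{1..n} -> Prop) :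
    x \in X ->
    vertex_splittable_in (X :\ x) I1 ->
    vertex_splittable_in (X :\ x) I2 ->
    eq_ideal I (sum_ideal (mulX_ideal X x I1) (span_in X I2)) ->
    (forall f, I2 f -> I1 f) ->
    min_gens X (mulX_ideal X x I1) M1 ->
    min_gens X (span_in X I2) M2 ->
    (forall m, ~ (M1 m /\ M2 m)) ->
    min_gens X I (fun m => M1 m \/ M2 m) ->
    vertex_splittable_in X I.

Definition vertex_splittable I : Prop :=
  vertex_splittable_in [set: 'I_n] I.

End Ideals.

Definition edge_ideal (K : fieldType) (n : nat) (H : sgraph 'I_n) :
    {mpoly K[n]} -> Prop :=
  span (fun f => exists x y, H x y /\ f = 'X_x * 'X_y).
Arguments edge_ideal K {n} H f.

Definition wo_edge_ideal (K : fieldType) (n : nat) (D : wograph n) :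
    {mpoly K[n]} -> Prop :=
  span (fun f => exists x y, arc D x y /\ f = 'X_x * 'X_y ^+ weight D y).
Arguments wo_edge_ideal K {n} D f.

Definition nontrivial_weights (n : nat) (D : wograph n) : {set 'I_n} :=
  [set x | (1 < weight D x)%N].

(* H = H(I(D)_<2>): the subgraph H of G with I(H) = I(D)_<2>. Such an H exists
   ([degree2_graph_exists]) and is unique: its edges are the {x, y} with
   x y \in I(D). *)
Definition degree2_graph (K : fieldType) (n : nat) (D : wograph n)
    (H : sgraph 'I_n) : Prop :=
  subrel H (underlying D) /\
  eq_ideal (edge_ideal K H) (degree_component 2 (wo_edge_ideal K D)).

Section Degree2Graph.
Variables (K : fieldType) (n : nat) (D : wograph n).
Local Notation R := {mpoly K[n]}.

Lemma poly_in_setT (p : R) : poly_in [set: 'I_n] p.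
Proof. by apply/allP => m _; apply/forallP => i; rewrite inE implybT. Qed.

Lemma mem_span (S : R -> Prop) f : S f -> span S f.
Proof.
move=> Sf; exists [:: (1, f)]; last by rewrite big_seq1 mul1r.
by move=> c; rewrite inE => /eqP ->; split=> //; exact: poly_in_setT.
Qed.

Lemma span0 (S : R -> Prop) : span S 0.
Proof. by exists [::]; rewrite ?big_nil. Qed.

Lemma spanD (S : R -> Prop) f g : span S f -> span S g -> span S (f + g).
Proof.
move=> [s Hs ->] [t Ht ->]; exists (s ++ t); last by rewrite big_cat.
by move=> c; rewrite mem_cat => /orP[/Hs|/Ht].
Qed.

Lemma spanM (S : R -> Prop) h f : span S f -> span S (h * f).
Proof.
move=> [s Hs ->]; exists [seq (h * c.1, c.2) | c <- s].
  move=> c /mapP[d /Hs[_ Sd] ->]; split=> //; exact: poly_in_setT.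
by rewrite big_map mulr_sumr; apply: eq_bigr => c _; rewrite mulrA.
Qed.

Lemma span_sum (S : R -> Prop) (T : eqType) (s : seq T) (F : T -> R) :
  (forall c, c \in s -> span S (F c)) -> span S (\sum_(c <- s) F c).
Proof.
elim: s => [|c s IHs] HF; first by rewrite big_nil; exact: span0.
rewrite big_cons; apply: spanD; first by apply: HF; rewrite mem_head.
by apply: IHs => d ds; apply: HF; rewrite inE ds orbT.
Qed.

Lemma span_min (S S' : R -> Prop) f :
  (forall g, S g -> span S' g) -> span S f -> span S' f.
Proof.
move=> SS' [s Hs ->]; apply: span_sum => c /Hs[_ /SS' Sc]; exact: spanM.
Qed.

Let e : rel 'I_n := [rel x y | arc D x y && (weight D y == 1%N)
                               || arc D y x && (weight D x == 1%N)].

Let e_sym : ssrbool.symmetric e. Proof. by move=> x y; rewrite /e /= orbC. Qed.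
Let e_irr : irreflexive e. Proof. by move=> x; rewrite /e /= !arc_irr. Qed.

Lemma degree2_graph_exists : exists H, degree2_graph K D H.
Proof.
exists (SGraph e_sym e_irr); split.
  by move=> x y /orP[] /andP[a _]; apply/orP; [left|right].
move=> f; split; apply: span_min => g.
  case=> x [y [exy ->]]; apply: mem_span; split; last first.
    by rewrite -mpolyXD dhomogX /= mdegD !mdeg1.
  case/orP: exy => /andP[a /eqP w]; apply: mem_span.
    by exists x, y; rewrite w expr1.
  by exists y, x; rewrite w expr1 mulrC.
case=> [[s Hs ->] /pihomog_dE <-]; rewrite raddf_sum /=.
apply: span_sum => c /Hs[_ [x [y [axy ->]]]].
rewrite {1}(mpolyE c.1) mulr_suml raddf_sum /=.
apply: span_sum => m _; rewrite -scalerAl mpolyXn -!mpolyXD linearZ /=.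
rewrite -mul_mpolyC; apply: spanM; rewrite pihomogX.
case: ifP => [|_]; last exact: span0.
rewrite /= mdegD mdegD mdegMn !mdeg1 => /eqP dm.
have w0 := weight_gt0 D y.
have w : weight D y = 1%N by case: (weight D y) w0 dm => [|[|k]] //; lia.
rewrite w mulm1n !mpolyXD; apply: spanM; apply: mem_span.
by exists x, y; split=> //; apply/orP; left; rewrite axy w.
Qed.

End Degree2Graph.

(* Main.v *)
Require Import Defs.
From mathcomp Require Import all_boot all_order all_algebra.
From mathcomp Require Import zify.
From Stdlib Require Import ClassicalEpsilon.
Import Defs.

Set Implicit Arguments.
Unset Strict Implicit.
Unset Printing Implicit Defensive.

(** Let [G] be the underlying graph of [D] and [I] its edge ideal. The proof goes
    around the cycle: componentwise linear, co-chordal, vertex splittable, linear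
    quotients, componentwise linear.

    _Linear components force co-chordality._ An induced cycle [c] with [l > 3]
    vertices in the complement of a graph contributes a class to
    [Tor_{l-2}(R/J, K)] in a degree that a linear resolution of [J] excludes
    ([cycle_obstruction]). With [J = I_<2>] this makes [H] co-chordal. For [G], let
    [y] be the vertex of weight [w > 1]. A cycle that avoids [y] is already a cycle
    for [H]. On a cycle through [y], no vertex is adjacent to [y] in [H]:
    otherwise [y] and an arc of the cycle would form an induced cycle in the
    complement of [H] ([cycle_shortcut]). Every vertex of the cycle adjacent to
    [y] then enters [I] through [y ^ w], and the obstruction applies to
    [I_<w+1>] in the multidegree of [y ^ (w-1)] times the product of the cycle.

    Tor is computed with the chains on the full simplex of variables, a free
    resolution of the residue field in which a chain is merely a function on
    sequences of variables ([simplex_exact]). Comparing it with the given resolution of [J] is a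
    diagram chase ([zigzag]); the class is detected by pairing it with an
    explicit cocycle, a sum of determinants indexed by the edges of the cycle
    ([cycle_cochain]).

    _Co-chordality gives a vertex splitting._ If [x] has weight 1 and is simplicial
    in the complements of both [G] and [H], then every generator not involving [x]
    is divisible by one of the powers [u] or [u ^ w] that complete [x] to a
    generator. So [I = x I1 + I2] with [I1] generated by powers of variables and
    [I2] the edge ideal of [D - x], and one concludes by induction
    ([vertex_splittable_arcs]). That such an [x] exists is Dirac's theorem on
    simplicial vertices of chordal graphs ([dirac], [common_simplicial]).

    _Vertex splittings have linear quotients._ In [I = x I1 + I2], list the
    generators of [x I1] before those of [I2] ([vertex_splittable_lq]).

    _Linear quotients give linear components._ If [I] has linear quotients, so has
    every [I_<d>], with respect to a list of monomials of degree [d] ([lq_trunc]).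
    Along such a list the resolution grows by extensions by the resolutions of
    ideals of variables, which keep it linear ([horseshoe], [linear_lq]). *)

(** * Chordal graphs *)

Section ChordalGraphs.
Variable T : finType.
Implicit Types (B : sgraph T) (S A : {set T}) (c : seq T) (x y u v w : T).

Lemma next_at_index x0 c i : uniq c -> i < size c ->
  next c (nth x0 c i) = nth x0 c (if i.+1 < size c then i.+1 else 0).
Proof.
case: c => [|a c] uc // ic; rewrite next_nth mem_nth // index_uniq //.
case: ltnP => [lt|ge]; first exact: set_nth_default.
by rewrite nth_default.
Qed.

Definition cycle_adj l i j := (j == i.+1) || (i == 0) && (j == l.-1).

Lemma cycle_adjE l i j : 2 < l -> i < j < l ->
  (j == if i.+1 < l then i.+1 else 0) || (i == if j.+1 < l then j.+1 else 0) =
  cycle_adj l i j.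
Proof. by rewrite /cycle_adj => *; do 2 case: ifP => ?; lia. Qed.

Lemma cycle_adj_irr l i : 2 < l -> i < l -> (i == if i.+1 < l then i.+1 else 0) = false.
Proof. by move=> *; case: ifP => ?; lia. Qed.

Lemma induced_cycle_nth x0 B c : uniq c -> 2 < size c ->
  (forall i j, i < j < size c -> B (nth x0 c i) (nth x0 c j) = cycle_adj (size c) i j) ->
  induced_cycle B c.
Proof.
move=> uc c2 Bij; split=> // x y /(nthP x0)[i ic <-] /(nthP x0)[j jc <-].
have nx k : k < size c -> (if k.+1 < size c then k.+1 else 0) < size c.
  by case: ifP => // _ _; apply: leq_trans c2.
rewrite !(next_at_index x0) // !nth_uniq ?nx //.
have [ij|ji|<-] := ltngtP i j.
- by rewrite Bij ?ij ?cycle_adjE ?ij.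
- by rewrite edge_sym Bij ?ji // orbC cycle_adjE ?ji.
by rewrite edge_irr cycle_adj_irr.
Qed.

Lemma induced_cycleP x0 B c : induced_cycle B c ->
  forall i j, i < j < size c -> B (nth x0 c i) (nth x0 c j) = cycle_adj (size c) i j.
Proof.
case=> uc c2 Bc i j /andP[ij jc]; have ic := ltn_trans ij jc.
have nx k : k < size c -> (if k.+1 < size c then k.+1 else 0) < size c.
  by case: ifP => // _ _; apply: leq_trans c2.
rewrite Bc ?mem_nth // !(next_at_index x0) // !nth_uniq ?nx //.
by rewrite cycle_adjE ?ij.
Qed.

Lemma induced_cycle_rot B c k : induced_cycle B c -> induced_cycle B (rot k c).
Proof.
case=> uc c2 Bc; split; rewrite ?rot_uniq ?size_rot //.
by move=> x y; rewrite !mem_rot => xc yc; rewrite Bc // !next_rot.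
Qed.

(** A walk of minimal length has neither repetitions nor chords. *)
Lemma induced_path (e : rel T) x y : connect e x y ->
  exists p, [/\ path e x p, last x p = y, uniq (x :: p)
    & forall i j, i < j <= size p ->
        e (nth x (x :: p) i) (nth x (x :: p) j) -> j = i.+1].
Proof.
move=> exy.
have ex : exists k, [exists p : k.-tuple T, path e x p && (last x p == y)].
  have /connectP[p ep ->] := exy; exists (size p); apply/existsP.
  by exists (in_tuple p); rewrite ep eqxx.
case: (ex_minnP ex) => k /existsP[p /andP[ep /eqP py]] kmin.
have minp q : path e x q -> last x q = y -> k <= size q.
  by move=> eq qy; apply: kmin; apply/existsP; exists (in_tuple q); rewrite eq qy eqxx.
have sp : size p = k := size_tuple p.
have last_take i : i <= size p -> last x (take i p) = nth x (x :: p) i.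
  case: i => [|i] ip; first by rewrite take0.
  by rewrite (last_nth x) size_takel // [LHS]/= nth_take.
have path_drop i : i <= size p -> path e (nth x (x :: p) i) (drop i p).
  move=> ip; have := ep; rewrite -{1}(cat_take_drop i p) cat_path => /andP[_].
  by rewrite last_take.
have last_drop i : i <= size p -> last (nth x (x :: p) i) (drop i p) = y.
  by move=> ip; rewrite -last_take // -last_cat cat_take_drop.
exists p; split=> //.
  apply: contraT => /(uniqPn x)[i [j [ij jp e_ij]]].
  rewrite /= ltnS in jp; have ip := ltnW (leq_trans ij jp).
  have := minp (take i p ++ drop j p).
  rewrite cat_path take_path // last_cat last_take // e_ij path_drop // last_drop //.
  by rewrite size_cat size_takel // size_drop => /(_ isT erefl); lia.
move=> i j /andP[ij jp] e_ij; apply/eqP; rewrite eqn_leq ij andbT leqNgt.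
apply/negP => lt_ij; have ip := ltnW (leq_trans ij jp).
have j0 : j.-1 < size p by lia.
have := minp (take i p ++ drop j.-1 p).
have dE : drop j.-1 p = nth x (x :: p) j :: drop j p.
  by rewrite (drop_nth x) //; case: (j) ij.
rewrite cat_path take_path // last_cat last_take // dE /= e_ij path_drop // last_drop //.
by rewrite size_cat size_takel //= size_drop => /(_ isT erefl); lia.
Qed.

(** The neighbours of a connected set [A] that share a neighbour [v] having none
    in [A] are pairwise adjacent: otherwise a shortest path through [A] would
    close up through [v] to a long induced cycle. *)
Lemma separator_clique B A w v x y : chordal B ->
  (forall a, a \in A -> connect (fun p q => [&& B p q, p \in A & q \in A]) w a) ->
  (forall a, a \in A -> ~~ B v a) ->
  v \notin A -> x \notin A -> y \notin A ->
  B v x -> B v y -> (exists2 a, a \in A & B x a) -> (exists2 a, a \in A & B y a) ->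
  x != y -> B x y.
Proof.
move=> chB conA nA vA xA yA vx vy [a aA xa] [b bA yb] xy.
apply: contraT => nxy.
pose Z := x |: (y |: A); pose e p q := [&& B p q, p \in Z & q \in Z].
have subZ : {subset A <= Z} by move=> z zA; rewrite !inE zA !orbT.
have e_sym : ssrbool.symmetric e.
  by move=> p q; rewrite /e edge_sym; congr (_ && _); exact: andbC.
have e_csym : connect_sym e by apply: sym_connect_sym.
have conZ z : z \in A -> connect e w z.
  move=> zA; apply: connect_sub (conA z zA) => p q /and3P[pq pA qA].
  by apply: connect1; rewrite /e pq !subZ.
have exy : connect e x y.
  apply: (@connect_trans _ _ a).
    by apply: connect1; rewrite /e xa !inE eqxx aA !orbT.
  apply: (@connect_trans _ _ w); first by rewrite e_csym conZ.
  apply: (@connect_trans _ _ b); first exact: conZ.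
  by apply: connect1; rewrite /e edge_sym yb !inE eqxx bA !orbT.
have [p [ep py up chordless]] := induced_path exy.
have p1 : 1 < size p.
  case: p ep py {up chordless} => [|z [|z' p]] //=; first by move=> _ xyE; rewrite xyE eqxx in xy.
  by move=> /andP[/and3P[xz _ _] _] zy; rewrite -zy xz in nxy.
pose s := x :: p.
have step i : i < size p -> e (nth x s i) (nth x s i.+1).
  by move=> ip; have /(pathP x)/(_ i ip) := ep.
have sZ i : i <= size p -> nth x s i \in Z.
  case: i => [|i] ip; first by rewrite !inE eqxx.
  by case/and3P: (step i ip).
have ylast : nth x s (size p) = y by rewrite -last_nth.
have sA i : 0 < i < size p -> nth x s i \in A.
  case/andP=> i0 ip; have := sZ i (ltnW ip); rewrite !inE => /or3P[| |//].
    rewrite -[x in _ == x]/(nth x s 0) nth_uniq ?ltnS //; last exact: ltnW.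
    by rewrite -leqn0 leqNgt i0.
  by rewrite -ylast nth_uniq /= ?ltnS ?leqnn ?(ltnW ip) // ltn_eqF.
have Bs i j : i < j <= size p -> B (nth x s i) (nth x s j) = (j == i.+1).
  move=> /andP[ij jp]; apply/idP/eqP => [Bij|->].
    apply: chordless; first by rewrite ij.
    by rewrite /e Bij !sZ // ltnW // (leq_trans ij).
  by case/and3P: (step i (leq_trans ij jp)).
have Bv i : i <= size p -> B v (nth x s i) = (i == 0) || (i == size p).
  move=> ip; have [->|i0] := posnP i; first by rewrite vx.
  have [->|iN] := eqVneq i (size p); first by rewrite ylast vy orbT.
  by rewrite (negbTE (nA _ (sA i _))) ?i0 ?ltn_neqAle ?iN // orbF -leqn0 leqNgt i0.
have vs : v \notin s.
  apply/negP => /(nthP x)[i]; rewrite /= ltnS => ip vE; have := sZ i ip.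
  rewrite vE !inE (negbTE vA) orbF => /orP[/eqP vE'|/eqP vE'].
    by rewrite vE' edge_irr in vx.
  by rewrite vE' edge_irr in vy.
suff /chB : induced_cycle B (v :: s) by rewrite /= ltnNge ltnS (leq_trans _ p1).
apply: (induced_cycle_nth (x0 := x)).
- by rewrite cons_uniq vs.
- by rewrite /= !ltnS ltnW.
move=> [|i] [|j] //; rewrite [size _]/= !ltnS => /andP[ij jp].
  by rewrite [nth _ _ _]/= [RHS]/= Bv.
by rewrite [in LHS]/= Bs ?ij //= /cycle_adj /= orbF eqSS.
Qed.

Definition simplicial B S u :=
  {in S &, forall x y, B u x -> B u y -> x != y -> B x y}.

(** Dirac: a vertex of a chordal graph that is not adjacent to all others has a
    simplicial non-neighbour. It is found in a component [A] of the
    non-neighbours, by induction on the subgraph formed by [A] and its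
    neighbours, which form a clique. *)
Lemma dirac B S v w : chordal B -> v \in S -> w \in S -> w != v -> ~~ B v w ->
  exists u, [/\ u \in S, u != v, ~~ B v u & simplicial B S u].
Proof.
move=> chB; move: {2}#|S|.+1 (ltnSn #|S|) => k.
elim: k S v w => // k IH S v w Sk vS wS wv nvw.
pose N := [set x in S | (x != v) && ~~ B v x].
pose e p q := [&& B p q, p \in N & q \in N].
pose A := [set a | connect e w a].
have wN : w \in N by rewrite !inE wS wv.
have AN a : a \in A -> a \in N.
  rewrite inE => /connectP[p ep ->]; case/lastP: p ep => [|p z]; first by [].
  by rewrite rcons_path last_rcons => /andP[_ /and3P[]].
have Astep a x : a \in A -> x \in N -> B a x -> x \in A.
  move=> aA xN ax; have aN := AN a aA; rewrite !inE in aA *.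
  by apply: connect_trans aA (connect1 _); rewrite /e ax aN.
have conA a : a \in A -> connect (fun p q => [&& B p q, p \in A & q \in A]) w a.
  rewrite inE => /connectP[p ep ->]; apply/connectP; exists p => //.
  have wA : w \in A by rewrite inE connect0.
  elim: p (w) wA ep => //= z p IHp u uA /andP[/and3P[uz uN zN] ep].
  have zA : z \in A by exact: Astep uz.
  by rewrite uz uA zA IHp.
have wA : w \in A by rewrite inE connect0.
pose Nb := [set x in S | (x \notin A) && [exists a in A, B x a]].
have NbP x : x \in Nb -> [/\ x \in S, x \notin A, B v x & exists2 a, a \in A & B x a].
  rewrite in_set => /and3P[xS xA /existsP[a /andP[aA xa]]]; split=> //; last by exists a.
  have := AN a aA; rewrite in_set => /and3P[_ av nva].
  apply: contraT => nvx; case/negP: xA; apply: (Astep a) => //; last by rewrite edge_sym.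
  rewrite !inE xS nvx andbT; apply: contraNneq nva => <-.
  exact: xa.
have NbC x y : x \in Nb -> y \in Nb -> x != y -> B x y.
  move=> /NbP[xS xA vx xa] /NbP[yS yA vy ya].
  apply: (separator_clique chB conA _ _ xA yA vx vy xa ya) => [a /AN|].
    by rewrite !inE => /and3P[].
  by apply/negP => /AN; rewrite !inE eqxx andbF.
pose S' := A :|: Nb.
have S'S : {subset S' <= S}.
  by move=> x; rewrite in_setU => /orP[/AN|/NbP[]//]; rewrite !inE => /andP[].
have vS' : v \notin S'.
  rewrite in_setU negb_or; apply/andP; split; apply/negP; first by move=> /AN; rewrite !inE eqxx andbF.
  by move=> /NbP[_ _]; rewrite edge_irr.
have S'k : #|S'| < k.
  rewrite -ltnS; apply: leq_trans Sk; rewrite ltnS; apply: proper_card.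
  by apply/properP; split; [apply/subsetP | exists v].
suff [u uA simp] : exists2 u, u \in A & simplicial B S' u.
  have := AN u uA; rewrite in_set => /and3P[uS uv nvu].
  exists u; split=> // x y xS yS ux uy.
  have nbS' z : z \in S -> B u z -> z \in S'.
    move=> zS uz; rewrite in_setU; case: (boolP (z \in A)) => //= zA.
    by rewrite in_set zS zA; apply/existsP; exists u; rewrite uA edge_sym.
  by apply: simp => //; exact: nbS'.
have [/existsP[p /andP[pNb /existsP[q /and3P[qS' qp npq]]]]|/existsPn univ] :=
  boolP [exists p in Nb, exists q in S', (q != p) && ~~ B p q].
  have pS' : p \in S' by rewrite in_setU pNb orbT.
  have [u [uS' up npu simp]] := IH S' p q S'k pS' qS' qp npq.
  exists u => //; move: uS'; rewrite in_setU => /orP[//|uNb].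
  by case/negP: npu; apply: NbC; rewrite // eq_sym.
have {}univ p q : p \in Nb -> q \in S' -> q != p -> B p q.
  move=> pNb qS' qp; have := univ p; rewrite pNb /= => /existsPn/(_ q).
  by rewrite qS' qp /= negbK.
have [/existsP[p /andP[pA /existsP[q /and3P[qS' qp npq]]]]|/existsPn clique] :=
  boolP [exists p in A, exists q in S', (q != p) && ~~ B p q].
  have pS' : p \in S' by rewrite in_setU pA.
  have [u [uS' up npu simp]] := IH S' p q S'k pS' qS' qp npq.
  exists u => //; move: (uS'); rewrite in_setU => /orP[//|uNb].
  by case/negP: npu; rewrite edge_sym univ // eq_sym.
exists w => // x y xS' yS' _ _ xy; move: xS'; rewrite in_setU => /orP[xA|xNb].
  have := clique x; rewrite xA /= => /existsPn/(_ y).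
  by rewrite yS' eq_sym xy /= negbK.
by apply: univ => //; rewrite eq_sym.
Qed.

(** In a graph that is not complete, [dirac] gives a simplicial vertex [u], and then
    a second one when it is applied at [u]. *)
Lemma exists_simplicial B S y z : chordal B -> z \in S -> z != y ->
  exists u, [/\ u \in S, u != y & simplicial B S u].
Proof.
move=> chB zS zy.
have [/existsP[v /andP[vS /existsP[w /and3P[wS wv nvw]]]]|/existsPn clique] :=
  boolP [exists v in S, exists w in S, (w != v) && ~~ B v w].
  have [u [uS uv nvu simp_u]] := dirac chB vS wS wv nvw.
  have [uy|] := eqVneq u y; last by exists u.
  rewrite eq_sym in uv; rewrite edge_sym in nvu.
  have [u' [u'S u'u _ simp']] := dirac chB uS vS uv nvu.
  by exists u'; split=> //; rewrite -uy.
exists z; split=> // x w xS wS _ _ xw; have := clique x; rewrite xS /= => /existsPn/(_ w).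
by rewrite wS eq_sym xw /= negbK.
Qed.

(** Around the cycle [y :: r] all chords issue from [y]. The neighbours of [y] that
    are closest to the missing one, on either side, bound an arc of [r] which
    closes up through [y] to an induced cycle of length at least four. *)
Lemma cycle_shortcut B y r k : uniq (y :: r) -> 
  (forall i j, i < j < size r -> B (nth y r i) (nth y r j) = (j == i.+1)) ->
  B y (nth y r 0) -> B y (nth y r (size r).-1) -> k < size r ->
  ~~ B y (nth y r k) -> ~ chordal B.
Proof.
move=> uyr Br By0 Byl kr nk chB.
pose P i := B y (nth y r i).
have k0 : 0 < k by case: (k) nk => //; rewrite By0.
have [i0 /andP[i0k Pi0] i0max] : exists2 i, (i < k) && P i & forall j, (j < k) && P j -> j <= i.
  have ex : exists i, (i < k) && P i by exists 0; rewrite k0.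
  have ub i : (i < k) && P i -> i <= k by case/andP => /ltnW.
  by case: (ex_maxnP ex ub) => i Pi imax; exists i.
have [j0 /and3P[kj0 j0r Pj0] j0min] :
    exists2 j, [&& k < j, j < size r & P j] & forall i, [&& k < i, i < size r & P i] -> j <= i.
  have ex : exists j, [&& k < j, j < size r & P j].
    have kl : k != (size r).-1 by apply: contraNneq nk => ->.
    exists (size r).-1; rewrite /P Byl andbT ltn_predL (leq_ltn_trans _ kr) // andbT.
    by rewrite ltn_neqAle kl -ltnS prednK // (leq_ltn_trans _ kr).
  by case: (ex_minnP ex) => j Pj jmin; exists j.
pose c := y :: take (j0 - i0).+1 (drop i0 r).
have sz : size (take (j0 - i0).+1 (drop i0 r)) = (j0 - i0).+1.
  by apply: size_takel; rewrite size_drop; lia.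
have nthc i : i <= j0 - i0 -> nth y c i.+1 = nth y r (i0 + i).
  by move=> ij /=; rewrite nth_take // nth_drop.
suff /chB : induced_cycle B c by rewrite /= sz; lia.
apply: (induced_cycle_nth (x0 := y)).
- apply: (subseq_uniq _ uyr); rewrite /= eqxx.
  exact: subseq_trans (take_subseq _ _) (drop_subseq _ _).
- by rewrite /= sz; lia.
move=> [|i] [|j]; rewrite // [size c]/= sz !ltnS => /andP[ij jl]; rewrite nthc //.
  rewrite /cycle_adj /= !eqSS; apply/idP/orP => [Pj|[/eqP->|/eqP->]].
  - have jk : i0 + j != k by apply: contraNneq nk => <-.
    have {}Pj : P (i0 + j) := Pj.
    by have := i0max (i0 + j); have := j0min (i0 + j); rewrite Pj !andbT; lia.
  - by rewrite addn0.
  - by rewrite subnKC //; lia.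
  rewrite nthc // Br; last by lia.
  by rewrite /cycle_adj /= orbF; lia.
exact: ltnW (leq_trans ij jl).
Qed.

Lemma induced_cycle_adj x0 B c i j : induced_cycle B c -> i < size c -> j < size c ->
  i != j -> B (nth x0 c i) (nth x0 c j) = cycle_adj (size c) i j || cycle_adj (size c) j i.
Proof.
move=> cc ic jc; rewrite neq_ltn => /orP[ij|ji].
  rewrite (induced_cycleP x0 cc) ?ij // [cycle_adj _ j i](_ : _ = false) ?orbF //.
  by rewrite /cycle_adj; lia.
rewrite edge_sym (induced_cycleP x0 cc) ?ji // [cycle_adj _ i j](_ : _ = false) //.
by rewrite /cycle_adj; lia.
Qed.

Lemma induced_cycle_triangle_free B c u v w : induced_cycle B c -> 3 < size c ->
  u \in c -> v \in c -> w \in c -> uniq [:: u; v; w] ->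
  [|| ~~ B u v, ~~ B u w | ~~ B v w].
Proof.
move=> cc c3 /(nthP u)[i ic <-] /(nthP u)[j jc <-] /(nthP u)[k kc <-].
have [uc _ _] := cc; rewrite /= !inE !nth_uniq // => /andP[/norP[ij ik] /andP[jk _]].
rewrite !(induced_cycle_adj u cc) //.
by move: (size c) c3 ic jc kc => l; rewrite /cycle_adj; lia.
Qed.

End ChordalGraphs.

Import Order.TTheory GRing.Theory.

Local Open Scope ring_scope.

(** * Monomial ideals *)

Section MonomialIdeals.
Variables (K : fieldType) (n : nat).
Local Notation R := {mpoly K[n]}.
Implicit Types (X : {set 'I_n}) (M N : 'X_{1..n} -> Prop) (f g : R).
Implicit Types (m u v w : 'X_{1..n}).

Definition multiple M m : Prop := exists2 m', M m' & (m' <= m)%MM.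

Lemma multiple_gen M m : M m -> multiple M m.
Proof. by move=> Mm; exists m => //; exact: lepm_refl. Qed.

Lemma multiple_le M m m' : multiple M m -> (m <= m')%MM -> multiple M m'.
Proof. by case=> u Mu um mm'; exists u => //; exact: lepm_trans um mm'. Qed.

Lemma mnm_inP X m : reflect (forall i, (0 < m i)%N -> i \in X) (mnm_in X m).
Proof.
rewrite /mnm_in; apply: (iffP forallP) => Xm i; last by apply/implyP; apply: Xm.
by have /implyP := Xm i.
Qed.

Lemma mnm_in_le X m m' : (m <= m')%MM -> mnm_in X m' -> mnm_in X m.
Proof.
move=> /mnm_lepP mm' /mnm_inP Xm'; apply/mnm_inP => i mi; apply: Xm'.
exact: leq_trans mi (mm' i).
Qed.

Lemma mnm_in_setT m : mnm_in [set: 'I_n] m.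
Proof. by apply/mnm_inP => i; rewrite inE. Qed.

Lemma mnm_in_sub X X' m : X \subset X' -> mnm_in X m -> mnm_in X' m.
Proof. by move=> XX' /mnm_inP Xm; apply/mnm_inP => i /Xm /(subsetP XX'). Qed.

Lemma mnm_in1 X i : mnm_in X U_(i)%MM = (i \in X).
Proof.
apply/mnm_inP/idP => [|Xi j]; first by apply; rewrite mnm1E eqxx.
by rewrite mnm1E; case: eqP => // <-.
Qed.

Lemma mnm_inD X m m' : mnm_in X (m + m')%MM = mnm_in X m && mnm_in X m'.
Proof.
apply/mnm_inP/andP => [Xmm'|[/mnm_inP Xm /mnm_inP Xm'] i].
  by split; apply/mnm_inP => i mi; apply: Xmm'; rewrite mnmDE; lia.
by rewrite mnmDE addn_gt0 => /orP[/Xm|/Xm'].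
Qed.

Lemma mnm_inMn X m k : mnm_in X m -> mnm_in X (m *+ k)%MM.
Proof.
move=> /mnm_inP Xm; apply/mnm_inP => i; rewrite mulmnE muln_gt0.
by case/andP => /Xm.
Qed.

Lemma poly_inP X f :
  poly_in X f <-> forall m, m \in msupp f -> mnm_in X m.
Proof. by rewrite /poly_in; split=> [/allP|fX]; last exact/allP. Qed.

Lemma poly_inX X m : mnm_in X m -> poly_in X ('X_[m] : R).
Proof. by move=> Xm; apply/poly_inP => m' /mem_msuppXP <-. Qed.

Lemma poly_in0 X : poly_in X (0 : R).
Proof. by apply/poly_inP => m; rewrite msupp0. Qed.

Lemma poly_in1 X : poly_in X (1 : R).
Proof. by rewrite -mpolyX0; apply: poly_inX; apply/mnm_inP=> i; rewrite mnm0E. Qed.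

Lemma poly_inD X f g : poly_in X f -> poly_in X g -> poly_in X (f + g).
Proof.
move=> /poly_inP Xf /poly_inP Xg; apply/poly_inP => m /msuppD_le.
by rewrite mem_cat => /orP[/Xf|/Xg].
Qed.

Lemma poly_inM X f g : poly_in X f -> poly_in X g -> poly_in X (f * g).
Proof.
move=> /poly_inP Xf /poly_inP Xg; apply/poly_inP => m /msuppM_le.
by case/allpairsP=> -[m1 m2] /= [/Xf ? /Xg ? ->]; rewrite mnm_inD; apply/andP.
Qed.

Lemma poly_inZ X c f : poly_in X f -> poly_in X (c *: f).
Proof. by move=> /poly_inP Xf; apply/poly_inP => m /msuppZ_le /Xf. Qed.

Lemma poly_in_sub X X' f : X \subset X' -> poly_in X f -> poly_in X' f.
Proof.
by move=> XX' /poly_inP Xf; apply/poly_inP => m /Xf; exact: mnm_in_sub.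
Qed.

Lemma span_in0 X (S : R -> Prop) : span_in X S 0.
Proof. by exists [::]; rewrite ?big_nil. Qed.

Lemma span_inD X (S : R -> Prop) f g :
  span_in X S f -> span_in X S g -> span_in X S (f + g).
Proof.
move=> [s Hs ->] [t Ht ->]; exists (s ++ t); last by rewrite big_cat.
by move=> c; rewrite mem_cat => /orP[/Hs|/Ht].
Qed.

Lemma span_inM X (S : R -> Prop) h f :
  poly_in X h -> span_in X S f -> span_in X S (h * f).
Proof.
move=> Xh [s Hs ->]; exists [seq (h * c.1, c.2) | c <- s].
  by move=> c /mapP[d /Hs[Xd Sd] ->]; split=> //; exact: poly_inM.
by rewrite big_map mulr_sumr; apply: eq_bigr => c _; rewrite mulrA.
Qed.

Lemma mem_span_in X (S : R -> Prop) f : S f -> span_in X S f.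
Proof.
move=> Sf; exists [:: (1, f)]; last by rewrite big_seq1 mul1r.
by move=> c; rewrite inE => /eqP ->; split=> //; exact: poly_in1.
Qed.

Lemma span_in_sum X (S : R -> Prop) (T : eqType) (s : seq T) (F : T -> R) :
  (forall c, c \in s -> span_in X S (F c)) ->
  span_in X S (\sum_(c <- s) F c).
Proof.
elim: s => [|c s IHs] HF; first by rewrite big_nil; exact: span_in0.
rewrite big_cons; apply: span_inD; first by apply: HF; rewrite mem_head.
by apply: IHs => d ds; apply: HF; rewrite inE ds orbT.
Qed.

Lemma span_in_min X X' (S S' : R -> Prop) f : X \subset X' ->
  (forall g, S g -> span_in X' S' g) -> span_in X S f -> span_in X' S' f.
Proof.
move=> XX' SS' [s Hs ->]; apply: span_in_sum => c /Hs[Xc /SS' Sc].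
by apply: span_inM => //; exact: poly_in_sub Xc.
Qed.

(** An ideal generated by monomials is determined by the monomials that it
    contains; this reduces every statement about such ideals to divisibility
    of exponent vectors. *)
Lemma mem_span_monomials X M f :
  (forall m, M m -> mnm_in X m) ->
  span_in X (monomials M) f <->
  poly_in X f /\ forall m, m \in msupp f -> multiple M m.
Proof.
move=> XM; split.
  move=> [s Hs ->]; elim: s Hs => [|c s IHs] Hs.
    by rewrite big_nil; split; [exact: poly_in0 | move=> m; rewrite msupp0].
  rewrite big_cons.
  have [|IH1 IH2] := IHs; first by move=> d ds; apply: Hs; rewrite inE ds orbT.
  have [Xc [m0 Mm0 ->]] := Hs c (mem_head _ _).
  split; first by apply: poly_inD => //; apply: poly_inM => //; apply/poly_inX/XM.
  move=> m /msuppD_le; rewrite mem_cat => /orP[|/IH2 //] /msuppM_le.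
  case/allpairsP=> -[m1 m2] /= [_ /mem_msuppXP <- ->].
  by exists m0 => //; apply/mnm_lepP => i; rewrite mnmDE; lia.
case=> /poly_inP Xf Mf; rewrite (mpolyE f); apply: span_in_sum => m fm.
have [m0 Mm0 m0m] := Mf m fm.
rewrite -[m](submK m0m) mpolyXD scalerAl; apply: span_inM.
  apply/poly_inZ/poly_inX/(mnm_in_le _ (Xf m fm)).
  by apply/mnm_lepP => i; rewrite mnmBE; lia.
by apply: mem_span_in; exists m0.
Qed.

Lemma mem_spanM M f :
  span (monomials M) f <-> forall m, m \in msupp f -> multiple M m.
Proof.
have XM m : M m -> mnm_in [set: 'I_n] m by move=> _; exact: mnm_in_setT.
by rewrite /span mem_span_monomials //; split=> [[]|] // ?; split=> //; exact: poly_in_setT.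
Qed.

Lemma mem_span_inX X M m : (forall m', M m' -> mnm_in X m') -> mnm_in X m ->
  span_in X (monomials M) ('X_[m] : R) <-> multiple M m.
Proof.
move=> XM Xm; rewrite mem_span_monomials //; split=> [[_]|Mm].
  by apply; apply/mem_msuppXP.
by split; [exact: poly_inX | move=> m' /mem_msuppXP <-].
Qed.

Lemma mem_spanX M m : span (monomials M) ('X_[m] : R) <-> multiple M m.
Proof.
by rewrite /span mem_span_inX //; [move=> *|]; exact: mnm_in_setT.
Qed.

Lemma eq_span_in X (S S' : R -> Prop) :
  (forall f, S f <-> S' f) -> eq_ideal (span_in X S) (span_in X S').
Proof.
by move=> SS' f; split; apply: span_in_min => // g /SS' Sg; exact: mem_span_in.
Qed.

Lemma eq_monomials M M' : (forall m, M m <-> M' m) ->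
  forall f : R, monomials M f <-> monomials M' f.
Proof. by move=> MM' f; split=> -[m /MM' Mm ->]; exists m. Qed.

Lemma eq_span (S S' : R -> Prop) :
  (forall f, S f <-> S' f) -> eq_ideal (span S) (span S').
Proof. exact: eq_span_in. Qed.

(** ** Minimal generators *)

(** For monomials, minimality of a generating set amounts to the absence of
    divisibilities, the form in which all minimality conditions are used. *)
Lemma min_gensP X I M : (forall m, M m -> mnm_in X m) ->
  @min_gens K n X I M <->
  eq_ideal I (span_in X (monomials M)) /\
  (forall m m', M m -> M m' -> (m <= m')%MM -> m = m').
Proof.
move=> XM; split=> -[IM Mmin]; split=> //.
  move=> m m' Mm Mm' mm'; apply/eqP/negPn/negP => mNm'.
  have subM u : M u /\ u != m' -> M u by case.
  suff genM : eq_ideal I (span_in X (monomials (fun u => M u /\ u != m'))).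
    by have [_] := Mmin _ subM genM m' Mm'; rewrite eqxx.
  move=> f; rewrite IM; split; apply: span_in_min => // g [u].
    move=> Mu ->; apply/(mem_span_inX _ (XM u Mu)); first by move=> v [/XM].
    have [um'|uNm'] := eqVneq u m'; last exact: multiple_gen.
    by exists m; rewrite ?um'.
  by case=> Mu _ ->; apply: mem_span_in; exists u.
move=> M' M'M IM' m Mm.
have XM' u : M' u -> mnm_in X u by move=> /M'M /XM.
have : I 'X_[m] by apply/IM/mem_span_in; exists m.
move/IM'/(mem_span_inX XM' (XM m Mm)) => [m' M'm' m'm].
by rewrite -(Mmin _ _ (M'M _ M'm') Mm m'm).
Qed.

Lemma min_gens_sub X I M : @min_gens K n X I M ->
  eq_ideal I (span_in X (monomials M)).
Proof. by case. Qed.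

Lemma min_gens_ext X I M M' : (forall m, M m <-> M' m) ->
  @min_gens K n X I M -> @min_gens K n X I M'.
Proof.
move=> MM' [IM Mmin]; split=> [f|N NM' IN m /MM' Mm].
  rewrite IM; exact/eq_span_in/eq_monomials.
by apply: Mmin => // m' /NM' /MM'.
Qed.

Lemma min_gens_uniq X I M M' : (forall m, M' m -> mnm_in X m) ->
  @min_gens K n X I M -> @min_gens K n X I M' -> forall m, M m <-> M' m.
Proof.
move=> XM' gM gM'.
have XM m : M m -> mnm_in X m.
  move=> Mm; have : I 'X_[m] by apply/(min_gens_sub gM)/mem_span_in; exists m.
  move/(min_gens_sub gM')/(mem_span_monomials _ XM') => [/poly_inP Xm _].
  by apply: Xm; exact/mem_msuppXP.
move: gM gM' => /(min_gensP _ XM) [IM Mmin] /(min_gensP _ XM') [IM' M'min].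
suff sub N N' : (forall m, N m -> mnm_in X m) -> (forall m, N' m -> mnm_in X m) ->
    eq_ideal I (span_in X (monomials N)) ->
    eq_ideal I (span_in X (monomials N')) ->
    (forall m m', N m -> N m' -> (m <= m')%MM -> m = m') ->
    forall m, N m -> N' m.
  by move=> m; split; apply: sub.
move=> XN XN' IN IN' Nmin m Nm.
have : I 'X_[m] by apply/IN/mem_span_in; exists m.
move/IN'/(mem_span_inX XN' (XN m Nm)) => [m' N'm' m'm].
have : I 'X_[m'] by apply/IN'/mem_span_in; exists m'.
move/IN/(mem_span_inX XN (XN' m' N'm')) => [m'' Nm'' m''m'].
have e : m'' = m by apply: Nmin => //; exact: lepm_trans m''m' m'm.
suff -> : m = m' by [].
apply/mnmP => i; apply/eqP; rewrite eqn_leq.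
by move/mnm_lepP: m'm => ->; rewrite -e; move/mnm_lepP: m''m' => ->.
Qed.

End MonomialIdeals.

Lemma cat_eq_split (T : Type) (s1 s2 p q : seq T) (u : T) :
  s1 ++ s2 = p ++ u :: q ->
  (exists q', s1 = p ++ u :: q') \/ (exists2 p', p = s1 ++ p' & s2 = p' ++ u :: q).
Proof.
elim: s1 p => [|v s1 IH] [|v' p] /=.
- by move=> ->; right; exists [::].
- by move=> ->; right; exists (v' :: p).
- by case=> -> _; left; exists s1.
case=> -> /IH[[q' ->]|[p' -> ->]]; first by left; exists q'.
by right; exists p'.
Qed.

Lemma map_eq_split (T U : Type) (f : T -> U) s (p q : seq U) u :
  map f s = p ++ u :: q ->
  exists p' u' q', [/\ s = p' ++ u' :: q', p = map f p' & u = f u'].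
Proof.
elim: s p => [|v s IH] [|v' p] //=.
  by case=> <- _; exists [::], v, s.
by case=> <- /IH[p' [u' [q' [-> -> ->]]]]; exists (v :: p'), u', q'.
Qed.

(** * Linear quotients *)

Section LinearQuotients.
Variables (K : fieldType) (n : nat).
Local Notation R := {mpoly K[n]}.
Implicit Types (X : {set 'I_n}) (p q s : seq 'X_{1..n}).
Implicit Types (m u v w : 'X_{1..n}) (x : 'I_n).

Definition variables X : R -> Prop := fun f => exists2 x, x \in X & f = 'X_x.

Lemma mem_span_variables X f :
  span (variables X) f <->
  forall m, m \in msupp f -> exists2 x, x \in X & (0 < m x)%N.
Proof.
have XE g : variables X g <-> monomials (fun m => exists2 x, x \in X & m = U_(x)%MM) g.
  split=> [[x Xx ->]|[m [x Xx ->] ->]]; last by exists x.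
  by exists U_(x)%MM => //; exists x.
rewrite (eq_span XE) mem_spanM; split=> fX m /fX.
  case=> _ [x Xx ->] /mnm_lepP /(_ x); rewrite mnm1E eqxx => mx.
  by exists x.
case=> x Xx mx; exists U_(x)%MM; first by exists x.
by apply/mnm_lepP => i; rewrite mnm1E; case: eqP => [<-|].
Qed.

Lemma mem_colon_monomials (M : 'X_{1..n} -> Prop) u (f : R) :
  colon_ideal (span (monomials M)) 'X_[u] f <->
  forall m, m \in msupp f -> multiple M (u + m)%MM.
Proof.
rewrite /colon_ideal mem_spanM; split=> fM m.
  by move=> fm; apply: fM; rewrite (perm_mem (msuppMX _ _)); exact: map_f.
by rewrite (perm_mem (msuppMX _ _)) => /mapP[m' /fM ? ->].
Qed.

(** Divisibility form of the condition that the colon ideal of the monomials of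
    [p] by [u] is generated by variables: each of its monomial generators
    [v / gcd(u, v)] is divisible by a variable that belongs to it. *)
Definition lq_step p u : Prop := forall v, v \in p ->
  exists2 x, (u x < v x)%N & has (fun w => (w <= u + U_(x))%MM) p.

Lemma lq_stepP p u :
  lq_step p u <->
  exists X, eq_ideal (colon_ideal (span (monomials (fun m => m \in p))) 'X_[u])
                     (span (variables X)).
Proof.
split=> [lqpu|[X colonX] v pv].
  exists [set x | has (fun w => (w <= u + U_(x))%MM) p] => f.
  rewrite mem_colon_monomials mem_span_variables.
  split=> fM m /fM.
    case=> v /lqpu[x uvx xP] /mnm_lepP /(_ x); rewrite mnmDE => vm.
    by exists x; [rewrite inE | lia].
  case=> x; rewrite inE => /hasP[w pw /mnm_lepP wu] mx.
  exists w => //; apply/mnm_lepP => i; apply: leq_trans (wu i) _.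
  by rewrite !mnmDE mnm1E; case: eqP => [<-|] /=; lia.
have : colon_ideal (span (monomials (fun m => m \in p))) 'X_[u] ('X_[v - u] : R).
  apply/mem_colon_monomials => _ /mem_msuppXP <-; exists v => //.
  by apply/mnm_lepP => i; rewrite mnmDE mnmBE; lia.
move/colonX/mem_span_variables => /(_ (v - u)%MM).
case=> [|x Xx]; first exact/mem_msuppXP.
rewrite mnmBE subn_gt0 => uvx; exists x => //.
have /colonX : span (variables X) 'X_x by apply: mem_span; exists x.
move/mem_colon_monomials => /(_ U_(x)%MM).
case=> [|w pw wu]; first exact/mem_msuppXP.
by apply/hasP; exists w.
Qed.

Definition lq_seq s : Prop := forall p u q, s = p ++ u :: q -> lq_step p u.

Lemma linear_quotientsP (I : R -> Prop) :
  linear_quotients I <->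
  exists s, [/\ uniq s, min_gens [set: 'I_n] I (fun m => m \in s) & lq_seq s].
Proof.
split=> -[s [us Is lqs]]; exists s; split=> //.
  move=> p u q def_s; case: p def_s => [|v p] def_s // .
  have := lqs (size (v :: p)); rewrite def_s take_size_cat // nth_cat ltnn subnn.
  rewrite size_cat /= => H; apply/lq_stepP; apply: H; lia.
move=> i /andP[_ si].
have def_s : s = take i s ++ nth 0%MM s i :: drop i.+1 s.
  by rewrite -drop_nth // cat_take_drop.
by apply/lq_stepP; apply: lqs def_s.
Qed.

Lemma lepm_add2l m u v : (m + u <= m + v)%MM = (u <= v)%MM.
Proof.
by apply/mnm_lepP/mnm_lepP => le i; have := le i; rewrite !mnmDE leq_add2l.
Qed.

Lemma lq_step_shift m p u : lq_step p u -> lq_step (map (mnm_add m) p) (m + u)%MM.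
Proof.
move=> lqpu _ /mapP[v /lqpu[x uvx /hasP[w pw wu]] ->].
exists x; first by rewrite !mnmDE ltn_add2l.
apply/hasP; exists (m + w)%MM; first exact: map_f.
by rewrite -addmA lepm_add2l.
Qed.

Lemma lq_seq_map m s : lq_seq s -> lq_seq (map (mnm_add m) s).
Proof.
move=> lqs p u q e; have [p' [u' [q' [def_s -> ->]]]] := map_eq_split e.
by apply: lq_step_shift; apply: (lqs _ _ _ def_s).
Qed.

Lemma mulX_ideal_monomials X x (M : 'X_{1..n} -> Prop) (I1 : R -> Prop) :
  eq_ideal I1 (span_in (X :\ x) (monomials M)) ->
  eq_ideal (mulX_ideal X x I1)
    (span_in X (monomials (fun m => exists2 m', M m' & m = (U_(x) + m')%MM))).
Proof.
move=> I1M f; split; apply: span_in_min => // g.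
  case=> h /I1M [s Hs ->] ->; rewrite mulr_sumr; apply: span_in_sum => c /Hs[Xc].
  case=> m Mm ->; rewrite mulrCA -mpolyXD; apply: span_inM.
    by apply: poly_in_sub Xc; exact: subD1set.
  by apply: mem_span_in; exists (U_(x) + m)%MM => //; exists m.
case=> _ [m Mm ->] ->; rewrite mpolyXD; apply: mem_span_in; exists 'X_[m] => //.
by apply/I1M/mem_span_in; exists m.
Qed.

Lemma span_in_span X (Y : {set 'I_n}) (M : 'X_{1..n} -> Prop) (I1 : R -> Prop) : Y \subset X ->
  eq_ideal I1 (span_in Y (monomials M)) ->
  eq_ideal (span_in X I1) (span_in X (monomials M)).
Proof.
move=> YX I1M f; split; apply: span_in_min => // g.
  by move/I1M; apply: span_in_min => // h; exact: mem_span_in.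
by move=> Mg; apply/mem_span_in/I1M/mem_span_in.
Qed.

(** List the generators of [x I1] before those of [I2]: as [I2] lies in [I1], the
    colon of [x I1] by a generator of [I2] is [(x)]. *)
Lemma vertex_splittable_lq X (I : R -> Prop) : vertex_splittable_in X I ->
  exists s, [/\ uniq s, forall m, m \in s -> mnm_in X m,
                min_gens X I (fun m => m \in s) & lq_seq s].
Proof.
elim=> {X I} [X I v Xv Iv|X I I0|X I IX|].
- exists [:: v]; split=> //; last 1 first.
  + by move=> [|? [|? ?]] u q // _ ?.
  + by move=> m; rewrite inE => /eqP->.
  apply/min_gensP; first by move=> m; rewrite inE => /eqP->.
  split=> [f|m m']; last by rewrite !inE => /eqP-> /eqP->.
  rewrite Iv; apply: eq_span_in; apply: eq_monomials => m.
  by rewrite inE; split=> [->|/eqP].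
- exists [::]; split=> //; last by case.
  apply/min_gensP => //; split=> // f; rewrite I0; split=> [->|]; first exact: span_in0.
  by case=> -[|c s] Hs ->; rewrite /zero_ideal ?big_nil //; case: (Hs c (mem_head _ _)) => _ [].
- exists [:: 0%MM]; have X0 : mnm_in X 0%MM by apply/mnm_inP => i; rewrite mnm0E.
  split=> //.
  + by move=> m; rewrite inE => /eqP->.
  + apply/min_gensP; first by move=> m; rewrite inE => /eqP->.
    split=> [f|m m']; last by rewrite !inE => /eqP-> /eqP->.
    rewrite IX mem_span_monomials; last by move=> m; rewrite inE => /eqP->.
    split=> [Xf|[]//]; split=> // m _; exists 0%MM; first by rewrite inE.
    by apply/mnm_lepP => i; rewrite mnm0E.
  + by move=> [|? [|? ?]] u q // _ ?.
move=> X I x I1 I2 M1 M2 xX _ [s1 [us1 Xs1 Is1 lqs1]] _ [s2 [us2 Xs2 Is2 lqs2]].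
move=> II I21 IM1 IM2 M12 IM.
have subX : X :\ x \subset X := subD1set _ _.
pose s1x := map (mnm_add U_(x)%MM) s1.
have XS1 m : m \in s1x -> mnm_in X m.
  case/mapP=> m' /Xs1 Xm' ->; rewrite mnm_inD mnm_in1 xX.
  exact: mnm_in_sub Xm'.
have XS2 m : m \in s2 -> mnm_in X m by move/Xs2; exact: mnm_in_sub.
have I1M : eq_ideal (mulX_ideal X x I1) (span_in X (monomials (fun m => m \in s1x))).
  move=> f; rewrite (mulX_ideal_monomials (min_gens_sub Is1)).
  apply: eq_span_in; apply: eq_monomials => m.
  split=> [[m' s1m' ->]|/mapP[m' s1m' ->]]; first exact: map_f.
  by exists m'.
have I2M := span_in_span subX (min_gens_sub Is2).
have HM1 : forall m, M1 m <-> m \in s1x.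
  apply: (min_gens_uniq XS1 IM1); apply/min_gensP => //; split=> // m m'.
  case/mapP=> u s1u -> /mapP[v s1v ->]; rewrite lepm_add2l => uv.
  by have /(min_gensP _ Xs1)[_ /(_ u v s1u s1v uv) ->] := Is1.
have HM2 : forall m, M2 m <-> m \in s2.
  apply: (min_gens_uniq XS2 IM2); apply/min_gensP => //; split=> // m m' s2m s2m'.
  by have /(min_gensP _ Xs2)[_] := Is2; apply.
exists (s1x ++ s2); split.
- rewrite cat_uniq us2 andbT map_inj_uniq ?us1 /=; last by move=> m m' /addmI.
  apply/hasPn => m s2m; apply/negP => s1m; apply: (M12 m).
  by split; [apply/HM1 | apply/HM2].
- by move=> m; rewrite mem_cat => /orP[/XS1|/XS2].
- apply: min_gens_ext IM => m; rewrite mem_cat; split=> [[/HM1->|/HM2->]|] //.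
    by rewrite orbT.
  by case/orP=> [/HM1|/HM2]; [left|right].
move=> p u q e12; have [[q' e]|[p' -> e]] := cat_eq_split e12.
  by apply: (lq_seq_map (m := U_(x)%MM) lqs1); exact: e.
have s2u : u \in s2 by rewrite e mem_cat mem_head orbT.
move=> v; rewrite mem_cat => /orP[/mapP[v' _ ->]|/(lqs2 _ _ _ e)[z uvz wP]]; last first.
  by exists z => //; rewrite has_cat wP orbT.
have ux : u x = 0%N.
  apply/eqP; rewrite -leqn0 leqNgt; apply/negP => ux.
  by have /mnm_inP/(_ x ux) := Xs2 u s2u; rewrite !inE eqxx.
exists x; first by rewrite ux mnmDE mnm1E eqxx.
rewrite has_cat; apply/orP; left.
have : I2 'X_[u] by apply/(min_gens_sub Is2)/mem_span_in; exists u.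
move/I21/(min_gens_sub Is1)/(mem_span_inX K Xs1 (Xs2 u s2u)) => [w s1w wu].
apply/hasP; exists (U_(x) + w)%MM; first exact: map_f.
by rewrite [(u + _)%MM]addmC lepm_add2l.
Qed.

Lemma vertex_splittable_linear_quotients (I : R -> Prop) :
  vertex_splittable I -> linear_quotients I.
Proof.
by move/vertex_splittable_lq => [s [? _ ? ?]]; apply/linear_quotientsP; exists s.
Qed.

End LinearQuotients.

(** * Linear quotients in a single degree *)

Lemma flatten_eq_split (T U : Type) (F : T -> seq U) s (P Q : seq U) (u : U) :
  flatten (map F s) = P ++ u :: Q ->
  exists s1 x s2 p q,
    [/\ s = s1 ++ x :: s2, F x = p ++ u :: q & P = flatten (map F s1) ++ p].
Proof.
elim: s P => [|x s IH] P /=; first by case: P.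
move=> e; have [[q e1]|[P' -> e1]] := cat_eq_split e.
  by exists [::], x, s, P, q; split.
have [s1 [x' [s2 [p [q [-> Fx ->]]]]]] := IH _ e1.
by exists (x :: s1), x', s2, p, q; split=> //=; rewrite catA.
Qed.

Section Truncation.
Variables (n : nat).
Implicit Types (m u v w : 'X_{1..n}) (p q s : seq 'X_{1..n}).

Lemma lepm_mdeg m m' : (m <= m')%MM -> (mdeg m <= mdeg m')%N.
Proof. by move=> mm'; rewrite -(submK mm') mdegD leq_addl. Qed.

Lemma lepm_mdeg_eq m m' : (m <= m')%MM -> mdeg m' = mdeg m -> m = m'.
Proof.
move=> mm' e; rewrite -(submK mm') in e *.
have /eqP : mdeg (m' - m) = 0%N by move: e; rewrite mdegD; lia.
by rewrite mdeg_eq0 => /eqP->; rewrite add0m.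
Qed.

Lemma lepm_addr m m' : (m <= m + m')%MM.
Proof. by apply/mnm_lepP => i; rewrite mnmDE leq_addr. Qed.

Lemma lepm_lt_exists m m' : (m <= m')%MM -> (mdeg m < mdeg m')%N ->
  exists x, (m x < m' x)%N.
Proof.
move=> /mnm_lepP mm' dlt; apply/existsP; apply: contraLR dlt.
rewrite negb_exists -leqNgt => /forallP ge.
by rewrite !mdegE; apply: leq_sum => i _; rewrite leqNgt.
Qed.

Lemma lepm_between d w m : (w <= m)%MM -> (mdeg w <= d <= mdeg m)%N ->
  exists2 m', (w <= m')%MM && (m' <= m)%MM & mdeg m' = d.
Proof.
move=> wm /andP[wd dm]; move e: (d - mdeg w)%N => k.
elim: k w wm wd e => [|k IH] w wm wd e.
  by exists w; [rewrite lepm_refl | lia].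
have [|x wx] := lepm_lt_exists wm; first lia.
have wxm : (w + U_(x) <= m)%MM.
  apply/mnm_lepP => i; rewrite mnmDE mnm1E; case: eqP => [<-|_] /=; first by lia.
  by move/mnm_lepP/(_ i): wm; lia.
have [||m' /andP[wm' m'm] <-] := IH _ wxm.
- by rewrite mdegD mdeg1; lia.
- by rewrite mdegD mdeg1; lia.
exists m' => //; rewrite m'm andbT.
exact: lepm_trans (lepm_addr _ _) wm'.
Qed.

(** Repetitions are allowed because the same monomial of degree [d] may be a multiple
    of several generators. *)
Definition lq_seq_dup s : Prop :=
  forall p u q, s = p ++ u :: q -> u \in p \/ lq_step p u.

Definition mons_of_deg e : seq 'X_{1..n} :=
  sort (fun m m' => (m' <= m)%O)
    [seq m <- [seq bmnm b | b : 'X_{1..n < e.+1}] | mdeg m == e].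

Lemma mem_mons_of_deg e m : (m \in mons_of_deg e) = (mdeg m == e).
Proof.
rewrite mem_sort mem_filter andb_idr // => /eqP dm.
have lt_m : (mdeg m < e.+1)%N by rewrite dm.
by apply/mapP; exists (BMultinom lt_m); rewrite ?mem_enum.
Qed.

(** Order the monomials of degree [e] lexicographically, the largest first. If [v]
    comes before [u], let [x_i] be the first variable in which they differ; [v] has the
    larger exponent there, hence a smaller one at some later [x_z], and
    [u x_i / x_z] also comes before [u]. *)
Lemma lq_mons_of_deg e : lq_seq_dup (mons_of_deg e).
Proof.
move=> p u q def_s.
have [|uNp] := boolP (u \in p); [by left | right].
have ps v : v \in p ++ u :: q -> mdeg v = e.
  by rewrite -def_s mem_mons_of_deg => /eqP.
have srt : sorted (fun m m' => (m' <= m)%O) (p ++ u :: q).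
  by rewrite -def_s; apply: sort_sorted => m m'; exact: le_total.
have tr : transitive (fun m m' : 'X_{1..n} => (m' <= m)%O).
  by move=> m1 m2 m3 h1 h2; exact: le_trans h2 h1.
move: srt; rewrite sorted_pairwise // pairwise_cat => /and3P[/allrelP pq _].
rewrite /= => /andP[/allP uq _].
have du : mdeg u = e by apply: ps; rewrite mem_cat mem_head orbT.
move=> v pv.
have dv : mdeg v = e by apply: ps; rewrite mem_cat pv.
have uv : (u < v)%O.
  by rewrite lt_neqAle pq ?mem_head // andbT; apply: contraNneq uNp => ->.
have [i eq_lt uvi] := elimT (ltmcP (etrans du (esym dv))) uv.
exists i => //.
have [z vuz] : exists z, (v z < u z)%N.
  apply/existsP; apply: contraPT (_ : mdeg u = mdeg v); last by rewrite du.
  rewrite negb_exists => /forallP ge; apply/eqP; rewrite neq_ltn; apply/orP; left.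
  rewrite !mdegE (bigD1 i) //= [X in (_ < X)%N](bigD1 i) //= -addSn leq_add //.
  by apply: leq_sum => j _; rewrite leqNgt.
have iz : i != z by apply: contraTneq vuz => <-; lia.
pose w := (u + U_(i) - U_(z))%MM.
have wle : (w <= u + U_(i))%MM by apply/mnm_lepP => j; rewrite mnmBE leq_subr.
apply/hasP; exists w => //.
have wz : (U_(z) <= u + U_(i))%MM.
  by apply/mnm_lepP => j; rewrite mnmDE !mnm1E; case: eqP => [<-|] /=; lia.
have dw : mdeg w = e.
  by have := congr1 (@mdeg n) (submK wz); rewrite !mdegD !mdeg1 du -/w; lia.
have uw : (u < w)%O.
  apply/ltmcP; first by rewrite du.
  exists i.
    move=> j ji; rewrite mnmBE mnmDE !mnm1E.
    have -> : (i == j) = false by apply/eqP => ij; move: ji; rewrite ij ltnn.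
    have -> : (z == j) = false.
      by apply/eqP => zj; move: (eq_lt j ji) vuz; rewrite zj; lia.
    by lia.
  by rewrite mnmBE mnmDE !mnm1E eqxx eq_sym (negbTE iz); lia.
have : w \in p ++ u :: q by rewrite -def_s mem_mons_of_deg dw.
rewrite mem_cat => /orP[//|]; rewrite inE => /orP[/eqP wu|/uq].
  by rewrite wu ltxx in uw.
by move/(lt_le_trans uw); rewrite ltxx.
Qed.

Variable (d : nat).

Definition trunc1 u : seq 'X_{1..n} :=
  if (mdeg u <= d)%N then map (mnm_add u) (mons_of_deg (d - mdeg u)%N) else [::].

Definition trunc s : seq 'X_{1..n} := flatten (map trunc1 s).

Lemma mem_trunc s m :
  m \in trunc s <-> mdeg m = d /\ multiple (fun u => u \in s) m.
Proof.
split.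
  case/flatten_mapP=> u su; rewrite /trunc1; case: leqP => // ud.
  case/mapP=> m'; rewrite mem_mons_of_deg => /eqP dm' ->.
  by rewrite mdegD dm' subnKC //; split=> //; exists u => //; exact: lepm_addr.
case=> dm [u su um]; apply/flatten_mapP; exists u => //.
rewrite /trunc1 -dm lepm_mdeg //; apply/mapP; exists (m - u)%MM.
  by rewrite mem_mons_of_deg -{2}(submK um) mdegD addnK.
by rewrite addmC submK.
Qed.

(** The multiples of degree [d] are listed generator by generator. A generator [w]
    that divides [u x] for a later generator [u] has degree at most that of [u], by
    minimality; so the multiples of [u] of degree [d] find suitable multiples of
    [w] before them. *)
Lemma lq_trunc s : {in s &, forall u v, (u <= v)%MM -> u = v} ->
  lq_seq s -> lq_seq_dup (trunc s).
Proof.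
move=> smin lqs P U Q e.
have [s1 [u [s2 [p [q [def_s Fu def_P]]]]]] := flatten_eq_split e.
move: Fu; rewrite /trunc1; case: leqP => [ud|]; last by case: (p).
move=> e1; have [p' [m [q' [dm def_p def_U]]]] := map_eq_split e1.
rewrite -/(trunc s1) in def_P; subst P p.
have su : u \in s by rewrite def_s mem_cat mem_head orbT.
have s1s v : v \in s1 -> v \in s by rewrite def_s mem_cat => ->.
have dU : mdeg U = d.
  have : m \in mons_of_deg (d - mdeg u)%N by rewrite dm mem_cat mem_head orbT.
  by rewrite def_U mdegD mem_mons_of_deg => /eqP->; rewrite subnKC.
have [/hasP[w s1w wU]|s1U] := boolP (has (fun w => (w <= U)%MM) s1).
  by left; rewrite mem_cat; apply/orP; left; apply/mem_trunc; split=> //; exists w.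
have [|lqm] := lq_mons_of_deg dm.
  by move=> p'm; left; rewrite mem_cat def_U map_f ?orbT.
right=> v; rewrite mem_cat => /orP[/mem_trunc[dv [v0 s1v0 v0v]]|].
  have [x uv0x /hasP[w s1w wux]] := lqs _ _ _ def_s v0 s1v0.
  have mx : m x = 0%N.
    apply/eqP; apply: contraNT s1U; rewrite -lt0n => mx.
    apply/hasP; exists w => //; apply: lepm_trans wux _.
    rewrite def_U lepm_add2l; apply/mnm_lepP => i; rewrite mnm1E.
    by case: eqP => [<-|].
  exists x.
    by rewrite def_U mnmDE mx addn0; move/mnm_lepP/(_ x): v0v; lia.
  have wNux : w != (u + U_(x))%MM.
    apply/eqP => ew; have : u = w.
      by apply: smin => //; [exact: s1s | rewrite ew lepm_addr].
    by move/(congr1 (@mdeg n)); rewrite ew mdegD mdeg1; lia.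
  have dw : (mdeg w <= mdeg u)%N.
    have := lepm_mdeg wux; rewrite mdegD mdeg1 leq_eqVlt => /orP[/eqP dw|]; last lia.
    by case/eqP: wNux; apply: lepm_mdeg_eq; rewrite // mdegD mdeg1.
  have wUx : (w <= U + U_(x))%MM.
    apply: lepm_trans wux _; rewrite def_U; apply/mnm_lepP => i.
    by rewrite !mnmDE; lia.
  have [|W /andP[wW WU] dW] := lepm_between (d := d) wUx.
    by rewrite mdegD mdeg1 dU; lia.
  rewrite has_cat; apply/orP; left; apply/hasP; exists W => //.
  by apply/mem_trunc; split=> //; exists w.
move=> /(lq_step_shift lqm)[x Uvx xP]; exists x; first by rewrite def_U.
by rewrite has_cat def_U xP orbT.
Qed.

End Truncation.

(** * Linear resolutions *)

Section Homogeneous.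
Variables (K : fieldType) (n : nat).
Local Notation R := {mpoly K[n]}.

Lemma pihomog_homog d e (p : R) : p \is d.-homog ->
  pihomog mdeg e p = if e == d then p else 0.
Proof.
move=> hp; case: eqVneq => [->|de]; first exact: pihomog_dE.
by apply: pihomog_ne0 hp; rewrite eq_sym.
Qed.

Lemma pihomogMr d e (p q : R) : q \is d.-homog ->
  pihomog mdeg e (p * q) = if (d <= e)%N then pihomog mdeg (e - d) p * q else 0.
Proof.
move=> hq; rewrite {1}(pihomog_partitionE (leqnn (mmeasure mdeg p))).
rewrite mulr_suml raddf_sum /=.
have E (i : nat) : pihomog mdeg e (pihomog mdeg i p * q) =
    if (e == i + d)%N then pihomog mdeg i p * q else 0.
  by apply: pihomog_homog; apply: dhomogM => //; exact: pihomogP.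
under eq_bigr do rewrite E.
case: (leqP d e) => de; last by rewrite big1 // => i _; case: eqP => //; lia.
case: (ltnP (e - d) (mmeasure mdeg p)) => kp.
  rewrite (bigD1 (Ordinal kp)) //= subnK // eqxx big1 ?addr0 // => i ik.
  by case: eqP => // eid; case/eqP: ik; apply: val_inj => /=; lia.
rewrite big1 => [|i _]; last by case: eqP => // eid; have := ltn_ord i; lia.
rewrite pihomogE big_seq_cond big1 ?mul0r // => m /andP[/mmeasure_mnm_lt lt_m].
move=> /eqP dm; have : (mdeg m < e - d)%N := leq_trans (lt_m _) kp.
have -> : mdeg m = (e - d)%N := dm.
by rewrite ltnn.
Qed.

Definition homog_mx d p q (A : 'M[R]_(p, q)) := forall i j, A i j \is d.-homog.

Definition comp_mx e p q (A : 'M[R]_(p, q)) := map_mx (pihomog mdeg e) A.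

Lemma comp_mxM d e p q r (A : 'M[R]_(p, q)) (B : 'M[R]_(q, r)) :
  homog_mx d B -> comp_mx (e + d) (A *m B) = comp_mx e A *m B.
Proof.
move=> hB; apply/matrixP => i j; rewrite !mxE raddf_sum; apply: eq_bigr => k _.
by rewrite mxE /= (pihomogMr _ _ (hB k j)) leq_addl addnK.
Qed.

Lemma comp_mxD e p q (A B : 'M[R]_(p, q)) :
  comp_mx e (A + B) = comp_mx e A + comp_mx e B.
Proof. by apply/matrixP => i j; rewrite !mxE raddfD. Qed.

Lemma comp_mx0 e p q : comp_mx e (0 : 'M[R]_(p, q)) = 0.
Proof. by apply/matrixP => i j; rewrite !mxE raddf0. Qed.

Lemma comp_mx_id d p q (A : 'M[R]_(p, q)) : homog_mx d A -> comp_mx d A = A.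
Proof. by move=> hA; apply/matrixP => i j; rewrite mxE pihomog_dE. Qed.

End Homogeneous.

Section LinearlyResolved.
Variables (K : fieldType) (n : nat).
Local Notation R := {mpoly K[n]}.

(** [M] is generated in degree [d], its first syzygies are generated by linear
    relations, and so on for ever. Rows are measured by the degree of their
    entries, so that every syzygy module is again generated in degree 1; such a
    resolution is minimal, as linear forms have no constant term. *)
CoInductive linearly_resolved (d r : nat) (M : 'rV[R]_r -> Prop) : Prop :=
  LinearlyResolved p (A : 'M[R]_(p, r)) of homog_mx d A
    & (forall u, M u <-> exists v, u = v *m A)
    & linearly_resolved 1 (fun v : 'rV_p => v *m A = 0).

(** An invariant only has to pass from a module to the syzygies of one of its
    generating systems; the resolution then unfolds from it. *)
Lemma linear_coind (P : forall d r, ('rV[R]_r -> Prop) -> Prop) :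
  (forall d r M, P d r M -> exists p (A : 'M[R]_(p, r)),
     [/\ homog_mx d A, forall u, M u <-> exists v, u = v *m A
       & P 1%N p (fun v => v *m A = 0)]) ->
  forall d r M, P d r M -> linearly_resolved d M.
Proof.
move=> HP; cofix IH => d r M /HP[p [A [hA MA PA]]].
exact: (LinearlyResolved hA MA (IH _ _ _ PA)).
Qed.

Lemma linear_ext d r (M M' : 'rV[R]_r -> Prop) :
  (forall u, M u <-> M' u) -> linearly_resolved d M -> linearly_resolved d M'.
Proof.
move=> MM' [p A hA MA lin]; apply: (LinearlyResolved hA _ lin) => u.
by rewrite -MA MM'.
Qed.

Lemma linear0 d r (M : 'rV[R]_r -> Prop) : (forall u, M u <-> u = 0) -> linearly_resolved d M.
Proof.
move: d r M; cofix IH => d r M M0.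
apply: (@LinearlyResolved d r M 0 (0 : 'M[R]_(0, r))); first by case.
  by move=> u; rewrite M0; split=> [->|[v ->]]; [exists 0|]; rewrite mulmx0.
by apply: IH => u; rewrite mulmx0; split=> // _; apply/matrixP => i [].
Qed.

(** Taking homogeneous components turns arbitrary lifts into lifts of degree [d]. *)
Lemma lift_rows e d t p q r (P : 'M[R]_(p, t)) (Q : 'M[R]_(q, t)) (A : 'M[R]_(r, q)) :
  homog_mx e P -> homog_mx e Q -> homog_mx d A ->
  (forall i, exists a, a *m P + row i A *m Q = 0) ->
  exists2 B : 'M[R]_(r, p), homog_mx d B & B *m P + A *m Q = 0.
Proof.
move=> hP hQ hA /fin_all_exists[a aPQ].
exists (\matrix_i comp_mx d (a i)) => [i j|]; first by rewrite !mxE pihomogP.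
apply/row_matrixP => i; rewrite row0 linearD /= !row_mul rowK -(comp_mxM _ _ hP).
have hAi : homog_mx d (row i A) by move=> k j; rewrite mxE.
rewrite -{1}(comp_mx_id hAi) -(comp_mxM _ _ hQ) -comp_mxD aPQ.
exact: comp_mx0.
Qed.

(** Horseshoe lemma, for the syzygies of [col_mx P Q]: they form an extension
    of [C], the relations among the rows of [Q] modulo those of [P], by the
    syzygies [A] of [P]. The generators of [C] lift to homogeneous syzygies, and
    the syzygies of the enlarged generating system have the same form again. *)
Lemma horseshoe e d t p q (P : 'M[R]_(p, t)) (Q : 'M[R]_(q, t))
    (A : 'rV[R]_p -> Prop) (C : 'rV[R]_q -> Prop) :
  homog_mx e P -> homog_mx e Q ->
  (forall a, A a <-> a *m P = 0) ->
  (forall c, C c <-> exists a, a *m P + c *m Q = 0) ->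
  linearly_resolved d A -> linearly_resolved d C ->
  linearly_resolved d (fun v => v *m col_mx P Q = 0).
Proof.
move=> hP hQ AP CPQ linA linC.
(* the invariant: modules of syzygies of this form, up to an equation of ranks *)
pose ext d r (M : 'rV[R]_r -> Prop) := exists e t p q
  (P : 'M[R]_(p, t)) (Q : 'M[R]_(q, t)) A C (rE : r = (p + q)%N),
  [/\ homog_mx e P, homog_mx e Q, forall a, A a <-> a *m P = 0,
      forall c, C c <-> exists a, a *m P + c *m Q = 0 &
      [/\ linearly_resolved d A, linearly_resolved d C
        & forall u, M u <-> castmx (erefl, rE) u *m col_mx P Q = 0]].
apply: (@linear_coind ext); last first.
  by exists e, t, p, q, P, Q, A, C, erefl; split=> //; split=> // u; rewrite castmx_id.
move=> {e t p q P Q A C hP hQ AP CPQ linA linC} {}d r M.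
case=> [e [t [p [q [P [Q [A [C [rE [hP hQ AP CPQ]]]]]]]]]] [].
case=> p' A' hA' AA' linA [q' C' hC' CC' linC]; subst r => MPQ.
have [|B hB BPQ] := lift_rows hP hQ hC'.
  by move=> i; apply/CPQ/CC'; exists (delta_mx 0 i); rewrite -rowE.
have A'P : A' *m P = 0.
  apply/row_matrixP => i; rewrite row0 row_mul; apply/AP/AA'.
  by exists (delta_mx 0 i); rewrite -rowE.
exists (p' + q')%N, (col_mx (row_mx A' 0) (row_mx B C')); split.
- move=> i j; rewrite -[i]splitK -[j]splitK.
  case: (split i) => i'; case: (split j) => j' /=;
    rewrite ?(col_mxEu, col_mxEd, row_mxEl, row_mxEr) //.
  by rewrite mxE; exact: dhomog0.
- move=> u; rewrite MPQ castmx_id -[u]hsubmxK; set a := lsubmx u; set c := rsubmx u.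
  rewrite mul_row_col; split=> [uPQ|[v vE]].
    have /CC'[c' c'E] : C c by apply/CPQ; exists a.
    have /AA'[a' a'E] : A (a - c' *m B).
      apply/AP; rewrite mulmxBl -mulmxA.
      move/eqP: BPQ; rewrite addr_eq0 => /eqP->.
      by rewrite mulmxN opprK mulmxA -c'E.
    exists (row_mx a' c'); rewrite mul_row_col !mul_mx_row add_row_mx mulmx0 add0r.
    by rewrite -a'E -c'E subrK.
  rewrite -mul_row_col vE -[v]hsubmxK mul_row_col !mul_mx_row add_row_mx mulmx0 add0r.
  rewrite mul_row_col mulmxDl -addrA -mulmxA -mulmxA A'P mulmx0 add0r -mulmxA -mulmxDr BPQ.
  by rewrite mulmx0.
exists d, (p + q)%N, p', q', (row_mx A' 0), (row_mx B C').
exists (fun a => a *m A' = 0), (fun c => c *m C' = 0), erefl; split.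
- move=> i j; rewrite -[j]splitK.
  by case: (split j) => j' /=; rewrite ?(row_mxEl, row_mxEr) // mxE dhomog0.
- move=> i j; rewrite -[j]splitK.
  by case: (split j) => j' /=; rewrite ?(row_mxEl, row_mxEr).
- move=> a; rewrite mul_mx_row mulmx0 -row_mx0; split=> [->//|/eq_row_mx[]//].
- move=> c; split=> [cC|[a]].
    have /AA'[a' a'E] : A (- (c *m B)).
      apply/AP; rewrite mulNmx -mulmxA; move/eqP: BPQ; rewrite addr_eq0 => /eqP->.
      by rewrite mulmxN opprK mulmxA cC mul0mx.
    exists a'; rewrite !mul_mx_row add_row_mx mulmx0 add0r cC -a'E.
    by rewrite addNr row_mx0.
  by rewrite !mul_mx_row add_row_mx mulmx0 add0r -row_mx0 => /eq_row_mx[].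
- by split=> // u; rewrite castmx_id.
Qed.

(** Ideals as submodules of the free module of rank one. *)
Definition ideal_of_row (I : R -> Prop) : 'rV[R]_1 -> Prop := fun u => I (u 0 0).

(** The syzygies of the enlarged generating system are an extension of [I : v] by the
    syzygies of the old one, so [horseshoe] applies. *)
Lemma linear_add_gen d (I J : R -> Prop) (v : R) :
  v \is d.-homog -> (forall f, J f <-> exists2 h, I h & exists c, f = h + c * v) ->
  (forall f g, I f -> I g -> I (f + g)) -> (forall c f, I f -> I (c * f)) ->
  linearly_resolved d (ideal_of_row I) -> linearly_resolved 1 (ideal_of_row (colon_ideal I v)) ->
  linearly_resolved d (ideal_of_row J).
Proof.
move=> hv JI ID IM [p A hA IA linA] linC.
have IE f : I f <-> exists a : 'rV_p, f = (a *m A) 0 0.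
  split=> [If|[a ->]]; last by apply/IA; exists a.
  have /IA[a aE] : ideal_of_row I f%:M by rewrite /ideal_of_row mxE eqxx.
  by exists a; rewrite -aE mxE eqxx.
apply: (@LinearlyResolved d 1 _ _ (col_mx A (v%:M : 'M_1))).
- move=> i j; rewrite -[i]splitK; case: (split i) => i' /=.
    by rewrite col_mxEu.
  by rewrite col_mxEd mxE !ord1 eqxx.
- move=> u; rewrite /ideal_of_row JI; split=> [[h /IE[a ->] [c uE]]|[w ->]].
    exists (row_mx a c%:M); rewrite mul_row_col -scalar_mxM.
    by apply/matrixP => i j; rewrite !ord1 uE [RHS]mxE [X in _ = _ + X]mxE.
  rewrite -[w]hsubmxK mul_row_col mxE.
  exists ((lsubmx w *m A) 0 0); first by apply/IE; exists (lsubmx w).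
  exists (rsubmx w 0 0); congr (_ + _).
  by rewrite mul_mx_scalar mxE mulrC.
apply: (horseshoe (e := d) (C := ideal_of_row (colon_ideal I v)) hA _ _ _ linA linC).
- by move=> i j; rewrite mxE !ord1 eqxx.
- by [].
move=> c; rewrite /ideal_of_row /colon_ideal IE; split=> -[a aE].
  exists (- a); apply/matrixP => i j; rewrite !ord1 mulNmx mul_mx_scalar !mxE.
  by rewrite [v * _]mulrC aE !mxE addNr.
exists (- a); rewrite mulNmx; move/eqP: aE; rewrite addr_eq0 => /eqP->.
by rewrite opprK mul_mx_scalar mxE mulrC.
Qed.

Lemma span_add_gen (M M' : 'X_{1..n} -> Prop) u (f : R) :
  (forall m, M' m <-> M m \/ m = u) ->
  span (monomials M') f <->
  exists2 h, span (monomials M) h & exists c, f = h + c * 'X_[u].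
Proof.
move=> M'E; split=> [[s Hs ->]|[h Mh [c ->]]].
  elim: s Hs => [|b s IHs] Hs.
    by exists 0; [exact: span0 | exists 0; rewrite big_nil mul0r addr0].
  have [|h Mh [c sE]] := IHs; first by move=> b' sb'; apply: Hs; rewrite inE sb' orbT.
  have [_ [m /M'E Mm b2]] := Hs b (mem_head _ _); rewrite big_cons sE b2 addrA.
  case: Mm => [Mm|->].
    exists (b.1 * 'X_[m] + h); last by exists c.
    by apply: spanD => //; apply/spanM/mem_span; exists m.
  by exists h => //; exists (b.1 + c); rewrite mulrDl addrCA addrA.
apply: spanD; last by apply/spanM/mem_span; exists u => //; apply/M'E; right.
by apply: span_min Mh => _ [m Mm ->]; apply: mem_span; exists m => //; apply/M'E; left.
Qed.

Lemma linear_add_monomial d (M M' : 'X_{1..n} -> Prop) u :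
  mdeg u = d -> (forall m, M' m <-> M m \/ m = u) ->
  linearly_resolved d (ideal_of_row (span (monomials M) : R -> Prop)) ->
  linearly_resolved 1 (ideal_of_row (colon_ideal (span (monomials M)) 'X_[u] : R -> Prop)) ->
  linearly_resolved d (ideal_of_row (span (monomials M') : R -> Prop)).
Proof.
move=> du M'E; apply: linear_add_gen.
- by rewrite dhomogX; apply/eqP.
- by move=> f; exact: span_add_gen.
- by move=> f g; exact: spanD.
- by move=> c f; exact: spanM.
Qed.

Lemma linear_variables (X : {set 'I_n}) :
  linearly_resolved 1 (ideal_of_row (span (variables X) : R -> Prop)).
Proof.
pose gens (Y : {set 'I_n}) m := exists2 x, x \in Y & m = U_(x)%MM.
have gensE (Y : {set 'I_n}) u :
    ideal_of_row (span (monomials (gens Y))) u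
    <-> ideal_of_row (span (variables Y) : R -> Prop) u.
  apply: eq_span => f; split=> [[m [x Yx ->] ->]|[x Yx ->]]; first by exists x.
  by exists U_(x)%MM => //; exists x.
apply: linear_ext (gensE X) _.
move e: #|X| => k; elim: k X e => [|k IH] X e.
  apply: linear0 => u; rewrite gensE /ideal_of_row; have -> := cards0_eq e.
  split=> [[s Hs] |->]; last by rewrite mxE; exact: span0.
  case: s Hs => [|c s] Hs; last by case: (Hs c (mem_head _ _)) => _ [x]; rewrite inE.
  by rewrite big_nil => u0; apply/matrixP => i j; rewrite !ord1 u0 mxE.
have [x Xx] : exists x, x \in X by apply/card_gt0P; rewrite e.
have {}IH : linearly_resolved 1 (ideal_of_row (span (monomials (gens (X :\ x))) : R -> Prop)).
  by apply: IH; move: e; rewrite (cardsD1 x) Xx => -[].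
apply: linear_add_monomial (IH) _; first exact: mdeg1.
  move=> m; split=> [[z Xz ->]|[[z]|->]].
  - by case: (eqVneq z x) => [->|zx]; [right | left; exists z; rewrite // !inE zx].
  - by rewrite !inE => /andP[_ Xz] ->; exists z.
  - by exists x.
(* a variable outside [X :\ x] is a nonzerodivisor modulo the others *)
apply: linear_ext IH => u; rewrite /ideal_of_row mem_colon_monomials mem_spanM.
split=> Xu m /Xu.
  by case=> w gw wm; exists w => //; apply: lepm_trans wm _; rewrite addmC lepm_addr.
case=> _ [z Xz ->] /mnm_lepP zm; exists U_(z)%MM; first by exists z.
apply/mnm_lepP => i; have := zm i; rewrite mnmDE !mnm1E; case: eqP => //= <-.
by move: Xz; rewrite !inE eq_sym => /andP[/negbTE-> _].
Qed.

(** Each new monomial is either a repetition or adds an extension by a linearly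
    resolved ideal of variables. *)
Lemma linear_lq d (s : seq 'X_{1..n}) :
  (forall m, m \in s -> mdeg m = d) -> lq_seq_dup s ->
  linearly_resolved d (ideal_of_row (span (monomials (fun m => m \in s)) : R -> Prop)).
Proof.
elim/last_ind: s => [|s u IH] ds lqs.
  apply: linear0 => v; rewrite /ideal_of_row mem_spanM.
  split=> [v0|-> m]; last by rewrite mxE msupp0.
  apply/matrixP => i j; rewrite !ord1 mxE; apply/eqP; rewrite -msupp_eq0.
  by case: (msupp _) v0 => // m r /(_ m (mem_head _ _)) [].
have {}IH : linearly_resolved d (ideal_of_row (span (monomials (fun m => m \in s)) : R -> Prop)).
  apply: IH => [m sm|p v q def_s]; first by apply: ds; rewrite mem_rcons inE sm orbT.
  by apply: (lqs p v (rcons q u)); rewrite def_s rcons_cat.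
have rconsE m : m \in rcons s u <-> m \in s \/ m = u.
  by rewrite mem_rcons inE; split=> [/orP[/eqP|]|[->|->]]; rewrite ?eqxx ?orbT; auto.
have [|su|/(lq_stepP K)[X XE]] := lqs s u [::]; first by rewrite cats1.
  apply: linear_ext IH => v; apply: eq_span; apply: eq_monomials => m.
  by rewrite rconsE; split=> [|[|->]]; auto.
have du : mdeg u = d by apply: ds; rewrite mem_rcons mem_head.
apply: (@linear_add_monomial _ (fun m => m \in s) _ u du rconsE IH).
by apply: linear_ext (linear_variables X) => v; rewrite /ideal_of_row XE.
Qed.

(** ** Extraction of a minimal resolution *)

(** A stage is one map of the resolution to be built, together with the proof that
    it can be continued; the next map is chosen from that proof. *)
Record stage := Stage {
  stage_deg : nat; stage_rank : nat; stage_gens : nat;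
  stage_mx : 'M[R]_(stage_gens, stage_rank);
  stage_homog : homog_mx stage_deg stage_mx;
  stage_syz : linearly_resolved 1 (fun v : 'rV_stage_gens => v *m stage_mx = 0) }.

Lemma next_stageP (S : stage) : exists T : {p : nat & 'M[R]_(p, stage_gens S)},
  [/\ homog_mx 1 (projT2 T),
     (forall u : 'rV_(stage_gens S), u *m stage_mx S = 0 <-> exists v, u = v *m projT2 T)
   & linearly_resolved 1 (fun v => v *m projT2 T = 0)].
Proof. by case: (stage_syz S) => p A hA AE linA; exists (existT _ p A). Qed.

Definition next_gens S := constructive_indefinite_description _ (next_stageP S).

Lemma next_homog S : homog_mx 1 (projT2 (sval (next_gens S))).
Proof. by case: (svalP (next_gens S)). Qed.

Lemma next_exact S (u : 'rV_(stage_gens S)) :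
  u *m stage_mx S = 0 <-> exists v, u = v *m projT2 (sval (next_gens S)).
Proof. by case: (svalP (next_gens S)) => _ ->. Qed.

Lemma next_syz S : linearly_resolved 1 (fun v => v *m projT2 (sval (next_gens S)) = 0).
Proof. by case: (svalP (next_gens S)). Qed.

Definition next_stage S : stage := Stage (@next_homog S) (next_syz S).

Lemma linear_has_resolution d (I : R -> Prop) :
  linearly_resolved d (ideal_of_row I) -> linear_resolution d I.
Proof.
case=> p A hA IA linA.
pose st := fix st i := if i is i'.+1 then next_stage (st i') else Stage hA linA.
have IE f : I f <-> exists u : 'rV_p, f = (u *m A) 0 0.
  split=> [If|[a ->]]; last by apply/IA; exists a.
  have /IA[a aE] : ideal_of_row I f%:M by rewrite /ideal_of_row mxE eqxx.
  by exists a; rewrite -aE mxE eqxx.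
have hdiff i (k : 'I_(stage_gens (st i.+1))) (l : 'I_(stage_gens (st i))) :
    stage_mx (st i.+1) k l \is 1.-homog by exact: (stage_homog (s := st i.+1)).
case: p A hA IA linA @st IE hdiff => [|p] A hA IA linA st IE hdiff.
  left=> f; rewrite IE /zero_ideal; split=> [[u ->]|->].
    by rewrite mxE big_ord0.
  by exists 0; rewrite mxE big_ord0.
right; unshelve eexists.
  apply: (@MinResolution K n I (fun i => stage_gens (st i)) (fun i _ => (d + i)%N)
            A (fun i => stage_mx (st i.+1))).
  - by move=> k; rewrite addn0; exact: hA.
  - by move=> i k l; rewrite /homog_of_degree_diff leq_add2l leqnSn subnDl subSnn.
  - exact: IE.
  - by move=> u; rewrite -(@next_exact (st 0)).
  - by move=> i u; rewrite -(@next_exact (st i.+1)).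
  - move=> i k l; apply: dhomog_nemf_coeff (hdiff i k l) _.
    by rewrite /= mdeg0.
by split=> [i k|] //=; exists 0%N; exists ord0.
Qed.

End LinearlyResolved.

Section LinearQuotientsComponentwise.
Variables (K : fieldType) (n : nat).
Local Notation R := {mpoly K[n]}.

Lemma degree_component_monomials d (M : 'X_{1..n} -> Prop) (I : R -> Prop) :
  eq_ideal I (span (monomials M)) ->
  eq_ideal (degree_component d I)
           (span (monomials (fun m => mdeg m = d /\ multiple M m))).
Proof.
move=> IM f; split; apply: span_min => g.
  case=> /IM/mem_spanM Mg /dhomogP hg; apply/mem_spanM => m gm.
  by apply: multiple_gen; split; [exact: hg | exact: Mg].
case=> m [dm Mm] ->; apply: mem_span; split; last by rewrite dhomogX; apply/eqP.
by apply/IM/mem_spanX.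
Qed.

Lemma linear_quotients_componentwise (I : R -> Prop) :
  linear_quotients I -> componentwise_linear I.
Proof.
case/linear_quotientsP => s [us Is lqs] d.
have XM m : m \in s -> mnm_in [set: 'I_n] m by move=> _; exact: mnm_in_setT.
have /(min_gensP _ XM)[IE smin] := Is.
have dE := degree_component_monomials d IE.
apply: linear_has_resolution.
have : linearly_resolved d (ideal_of_row (span (monomials (fun m => m \in trunc d s)) : R -> Prop)).
  apply: linear_lq; last exact: lq_trunc.
  by move=> m /mem_trunc[].
apply: linear_ext => u; rewrite /ideal_of_row dE.
by apply: eq_span; apply: eq_monomials => m; exact: mem_trunc.
Qed.

End LinearQuotientsComponentwise.

(** * The simplex resolution of the residue field *)

Section Boundary.
Variables (I : finType) (M : zmodType).
Implicit Types (g : seq I -> M) (s t : seq I) (v w : I).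

(** The value [g s] is the coefficient of a chain [g] on the ordered simplex [s],
    repeated vertices being allowed. This is the alternating boundary in
    coordinates: the coefficient of [s] collects, with alternating signs, those of
    all [t] from which [s] is obtained by deletion of one vertex; the recursion
    treats the insertion in front separately. *)
Fixpoint bd g s : M :=
  \sum_v g (v :: s) - (if s is w :: s' then bd (fun t => g (w :: t)) s' else 0).

Lemma bd_ext g g' s :
  (forall t, {subset s <= t} -> size t = (size s).+1 -> g t = g' t) ->
  bd g s = bd g' s.
Proof.
elim: s g g' => [|w s IH] g g' gg' /=; congr (_ - _).
- by apply: eq_bigr => v _; apply: gg'.
- by apply: eq_bigr => v _; apply: gg' => // u us; rewrite inE us orbT.
apply: IH => t st et; apply: gg' => /=; last by rewrite et.
by move=> u; rewrite !inE => /orP[->//|/st ->]; rewrite orbT.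
Qed.

Lemma bd_closed (P : M -> Prop) g s :
  P 0 -> (forall x y, P x -> P y -> P (x + y)) -> (forall x, P x -> P (- x)) ->
  (forall t, {subset s <= t} -> P (g t)) -> P (bd g s).
Proof.
move=> P0 PD PN; elim: s g => [|w s IH] g Pg /=.
  by apply: (PD _ _ _ (PN _ P0)); apply: (big_ind P P0 PD) => v _; apply: Pg.
apply: (PD).
  by apply: (big_ind P P0 PD) => v _; apply: Pg => u us; rewrite inE us orbT.
apply: (PN); apply: IH => t st; apply: Pg => u; rewrite !inE => /orP[->//|/st ->].
by rewrite orbT.
Qed.

Lemma bd0 g s : (forall t, {subset s <= t} -> g t = 0) -> bd g s = 0.
Proof.
apply: (bd_closed (P := fun x => x = 0)) => // [x y|x] ->; last exact: oppr0.
by move=> ->; rewrite addr0.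
Qed.

Lemma bdD g g' s : bd (fun t => g t + g' t) s = bd g s + bd g' s.
Proof.
elim: s g g' => [|w s IH] g g' /=; rewrite big_split /= ?subr0 //.
by rewrite IH opprD addrACA.
Qed.

Lemma bdN g s : bd (fun t => - g t) s = - bd g s.
Proof. by elim: s g => [|w s IH] g /=; rewrite sumrN ?subr0 // IH opprB addrC opprK. Qed.

Lemma bdB g g' s : bd (fun t => g t - g' t) s = bd g s - bd g' s.
Proof. by rewrite bdD bdN. Qed.

Lemma bd_sum (J : finType) (g : J -> seq I -> M) s :
  bd (fun t => \sum_j g j t) s = \sum_j bd (g j) s.
Proof.
elim: s g => [|w s IH] g /=; first by rewrite subr0 exchange_big; apply: eq_bigr => j _; rewrite subr0.
by rewrite exchange_big IH -sumrB.
Qed.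

Lemma bd_bd g s : bd (bd g) s = 0.
Proof.
elim: s g => [|w s IH] g.
  rewrite /= subr0; under eq_bigr do rewrite subr0.
  by rewrite sumrB exchange_big /= subrr.
rewrite [LHS]/=.
rewrite (bdB (fun t => \sum_v g (v :: w :: t)) (bd (fun t => g (w :: t)))) IH subr0.
rewrite (bd_sum (fun v t => g (v :: w :: t))) !sumrB exchange_big /= opprB.
by rewrite [_ + (_ - _)]addrC subrK subrr.
Qed.

(** Contraction of the simplex on the vertex set [I] onto its vertex [v0]. *)
Definition cone v0 g s : M := if s is v :: s' then if v == v0 then g s' else 0 else 0.

Lemma bd_cone v0 g s : bd (cone v0 g) s = g s - cone v0 (bd g) s.
Proof.
have E t : \sum_v cone v0 g (v :: t) = g t.
  by rewrite (bigD1 v0) //= eqxx big1 ?addr0 // => v /negbTE->.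
case: s => [|w s]; rewrite [bd _ _]/= -/(cone _ _) E //; congr (_ - _).
rewrite /cone; case: eqP => _; first by [].
by apply: bd0.
Qed.

End Boundary.

Lemma bd_morph (I : finType) (M N : zmodType) (f : M -> N) (g : seq I -> M) s :
  {morph f : x y / x - y} -> f (bd g s) = bd (fun t => f (g t)) s.
Proof.
move=> fB; have f0 : f 0 = 0 by rewrite -(subrr 0) fB subrr.
have fD : {morph f : x y / x + y}.
  by move=> x y; rewrite -{1}[y]opprK -{1}[- y]sub0r !fB f0 sub0r opprK.
elim: s g => [|w s IH] g /=; rewrite fB (big_morph f fD f0) ?f0 //.
by rewrite IH.
Qed.

Section Simplex.
Variables (K : fieldType) (n : nat).
Local Notation R := {mpoly K[n]}.
Implicit Types (s t : seq 'I_n) (m : 'X_{1..n}).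

(** The product [x_s] of the variables in [s], without repetitions. *)
Definition mnm_seq s : 'X_{1..n} := [multinom (v \in s : nat) | v < n].

Lemma mnm_seq_le s m :
  reflect (forall v, v \in s -> (0 < m v)%N) (mnm_seq s <= m)%MM.
Proof.
apply: (iffP mnm_lepP) => sm v; first by move=> vs; have := sm v; rewrite mnmE vs.
by rewrite mnmE; case: (boolP (v \in s)) => // /sm.
Qed.

Lemma divisible_byP (w : 'X_{1..n}) (p : R) :
  (exists f, p = 'X_[w] * f) <-> (forall m, m \in msupp p -> (w <= m)%MM).
Proof.
split=> [[f ->] m|wp].
  by rewrite mulrC (perm_mem (msuppMX _ _)) => /mapP[m' _ ->]; exact: lepm_addr.
exists (\sum_(m <- msupp p) p@_m *: 'X_[m - w]).
rewrite mulr_sumr {1}[p]mpolyE big_seq [RHS]big_seq; apply: eq_bigr => m /wp wm.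
by rewrite -scalerAr -mpolyXD addmC submK.
Qed.

(** The monomials [m] of [g] are coned off separately, each towards a variable that
    divides it. *)
Definition contraction (g : seq 'I_n -> R) s : R :=
  if s is v :: s' then
    \sum_(m <- msupp (g s') | [pick i | (0 < m i)%N] == Some v) (g s')@_m *: 'X_[m]
  else 0.

Lemma mcoeff_sum_msupp (P : pred 'X_{1..n}) (p : R) m :
  (\sum_(m <- msupp p | P m) p@_m *: 'X_[m])@_m = if P m then p@_m else 0.
Proof.
rewrite raddf_sum /= big_mkcond /=.
transitivity (\sum_(m' <- msupp p) if m' == m then (if P m then p@_m else 0) else 0).
  apply: eq_bigr => m' _; rewrite mcoeffZ mcoeffX.
  by case: eqP => [->|_]; case: ifP; rewrite ?mulr1 ?mulr0.
rewrite -big_mkcond /=; have [pm|pm] := boolP (m \in msupp p).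
  by rewrite -big_filter filter_pred1_uniq ?msupp_uniq // big_seq1.
rewrite big_seq_cond big1; last by move=> m' /andP[pm' /eqP e]; rewrite -e pm' in pm.
by rewrite (memN_msupp_eq0 pm) if_same.
Qed.

Lemma mcoeff_contraction g s m : (contraction g s)@_m =
  if [pick i | (0 < m i)%N] is Some v0 then cone v0 (fun t => (g t)@_m) s else 0.
Proof.
case: s => [|v s] /=; first by rewrite mcoeff0; case: pickP.
rewrite mcoeff_sum_msupp; case: pickP => [i _|_] //=.
by rewrite (inj_eq (@Some_inj _)) eq_sym.
Qed.

(** The complex of chains [g] with [x_s | g s] is a free resolution of the
    residue field: in multidegree [m <> 0] it is the chain complex of the full
    simplex on the support of [m], which is contractible. *)
Lemma simplex_exact (g : seq 'I_n -> R) q :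
  (forall s, exists f, g s = 'X_[mnm_seq s] * f) ->
  (forall s, size s = q -> (g s)@_0%MM = 0) ->
  (forall s, (size s).+1 = q -> bd g s = 0) ->
  exists2 b, (forall s, exists f, b s = 'X_[mnm_seq s] * f)
           & forall s, size s = q -> bd b s = g s.
Proof.
move=> gs g0 gbd; exists (contraction g) => [s|s sq].
  apply/divisible_byP => m; rewrite mcoeff_msupp mcoeff_contraction.
  case: pickP => [i mi|]; last by rewrite eqxx.
  case: s => [|v s] /=; first by rewrite eqxx.
  case: (v =P i) => [->|_]; last by rewrite eqxx.
  rewrite -mcoeff_msupp; move: (gs s) => /divisible_byP gsm /gsm /mnm_seq_le sm.
  by apply/mnm_seq_le => u; rewrite inE => /orP[/eqP->|/sm].
apply/mpolyP => m; rewrite (bd_morph _ _ (mcoeffB m)).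
rewrite (bd_ext (g' := fun t => if [pick i | (0 < m i)%N] is Some v0
    then cone v0 (fun t => (g t)@_m) t else 0)); last first.
  by move=> t _ _; exact: mcoeff_contraction.
case: pickP => [i mi|m0].
  rewrite bd_cone; case: s sq => [|v s] sq /=; first by rewrite subr0.
  rewrite -(bd_morph _ _ (mcoeffB m)) gbd /=; first by rewrite mcoeff0 if_same subr0.
  by rewrite -sq.
rewrite bd0 //; have -> : m = 0%MM; last by rewrite g0.
by apply/mnmP => i; rewrite mnm0E; have := m0 i; rewrite lt0n => /negbFE/eqP.
Qed.

(** The basis element [s] of the simplex resolution has multidegree [x_s]. When its
    coefficients are multiplied by [x_s], the differential becomes [bd], and the
    price is this divisibility. *)
Definition chain r (g : seq 'I_n -> 'rV[R]_r) : Prop :=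
  forall s, exists f, g s = 'X_[mnm_seq s] *: f.

Lemma chain_bd r (g : seq 'I_n -> 'rV[R]_r) : chain g -> chain (bd g).
Proof.
move=> gs s; apply: (bd_closed (P := fun x => exists f, x = 'X_[mnm_seq s] *: f)).
- by exists 0; rewrite scaler0.
- by move=> x y [f ->] [f' ->]; exists (f + f'); rewrite scalerDr.
- by move=> x [f ->]; exists (- f); rewrite scalerN.
move=> t st; have [f ->] := gs t.
have le : (mnm_seq s <= mnm_seq t)%MM.
  by apply/mnm_seq_le => v /st vt; rewrite mnmE vt.
by exists ('X_[mnm_seq t - mnm_seq s] *: f); rewrite scalerA -mpolyXD addmC submK.
Qed.

Lemma chain_exact r (g : seq 'I_n -> 'rV[R]_r) q : chain g ->
  (forall s k, size s = q -> (g s 0 k)@_0%MM = 0) ->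
  (forall s, (size s).+1 = q -> bd g s = 0) ->
  exists2 b, chain b & forall s, size s = q -> bd b s = g s.
Proof.
move=> gs g0 gbd.
have bdE (h : seq 'I_n -> 'rV[R]_r) k s : bd h s 0 k = bd (fun t => h t 0 k) s.
  by apply: (bd_morph (f := fun u : 'rV[R]_r => u 0 k)) => x y; rewrite !mxE.
have /fin_all_exists2 [b bs bg] : forall k, exists2 b : seq 'I_n -> R,
    (forall s, exists f, b s = 'X_[mnm_seq s] * f)
    & forall s, size s = q -> bd b s = g s 0 k.
  move=> k; apply: simplex_exact.
  - by move=> s; have [f ->] := gs s; exists (f 0 k); rewrite mxE.
  - by move=> s; exact: g0.
  - by move=> s sq; rewrite -bdE gbd // mxE.
exists (fun s => \row_k b k s) => [s|s sq].
  have /fin_all_exists[f fE] : forall k, exists f, b k s = 'X_[mnm_seq s] * f.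
    by move=> k; exact: bs.
  by exists (\row_k f k); apply/rowP => k; rewrite !mxE.
apply/rowP => k; rewrite bdE -bg //; apply: bd_ext => t _ _.
by rewrite mxE.
Qed.

End Simplex.

(** * Comparison with a linear resolution *)

Lemma functional_choice_on (A B : Type) (P : A -> Prop) (Q : A -> B -> Prop) (b0 : B) :
  (forall x, P x -> exists y, Q x y) -> exists f, forall x, P x -> Q x (f x).
Proof.
move=> H; have H' x : exists y, P x -> Q x y.
  have [/H[y Qxy]|nP] := excluded_middle_informative (P x); first by exists y.
  by exists b0.
exists (fun x => sval (constructive_indefinite_description _ (H' x))) => x.
exact: svalP (constructive_indefinite_description _ (H' x)).
Qed.

Section ZigZag.
Variables (K : fieldType) (n : nat).
Local Notation R := {mpoly K[n]}.

(** Homogeneity of degree [N] in a free module whose basis has degrees [sh]. *)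
Definition homog_row N r (sh : 'I_r -> nat) (u : 'rV[R]_r) : Prop :=
  forall k, homog_of_degree_diff N (sh k) (u 0 k).

(** Multiply a lift of [f] by [x ^ w] and keep only its component of degree [N]. *)
Lemma homog_row_lift N p r (shP : 'I_p -> nat) (shR : 'I_r -> nat) (A : 'M[R]_(p, r))
    (w : 'X_{1..n}) (f : 'rV_r) (v : 'rV_p) :
  (forall k l, homog_of_degree_diff (shP k) (shR l) (A k l)) ->
  homog_row N shR ('X_[w] *: f) -> f = v *m A ->
  exists u', [/\ homog_row N shP u', exists f', u' = 'X_[w] *: f' & 'X_[w] *: f = u' *m A].
Proof.
move=> hA hf fE.
exists (\row_k if (shP k <= N)%N then pihomog mdeg (N - shP k) ('X_[w] * v 0 k) else 0).
split.
- by move=> k; rewrite mxE /homog_of_degree_diff; case: leqP => // _; exact: pihomogP.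
- exists (\row_k if (shP k <= N)%N && (mdeg w <= N - shP k)%N
                 then pihomog mdeg (N - shP k - mdeg w) (v 0 k) else 0).
  apply/rowP => k; rewrite !mxE; case: leqP => /= _; last by rewrite mulr0.
  have hw : ('X_[w] : R) \is (mdeg w).-homog by rewrite dhomogX; apply/eqP.
  by rewrite mulrC (pihomogMr _ _ hw); case: ifP; rewrite ?mulr0 // mulrC.
apply/rowP => l; have := hf l; rewrite /homog_of_degree_diff fE scalemxAl !mxE.
case: leqP => lN hl; last first.
  rewrite hl big1 // => k _; rewrite mxE; case: leqP => kN; last by rewrite mul0r.
  have := hA k l; rewrite /homog_of_degree_diff leqNgt (leq_ltn_trans kN lN) /=.
  by move->; rewrite mulr0.
rewrite -(pihomog_dE hl) raddf_sum /=; apply: eq_bigr => k _; rewrite !mxE.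
have := hA k l; rewrite /homog_of_degree_diff; case: leqP => [lk|kl ->]; last first.
  by rewrite !mulr0 raddf0.
move=> hkl; rewrite (pihomogMr _ _ hkl).
have -> : (shP k - shR l <= N - shR l)%N = (shP k <= N)%N by lia.
case: leqP => kN; last by rewrite mul0r.
by rewrite subnBA // subnK //.
Qed.

Section Resolution.
Variables (d : nat) (I : R -> Prop) (F : min_resolution I).
Hypothesis linF : forall i (k : 'I_(res_rank F i)), (res_shift k <= d + i)%N.

Definition boundary i (u : 'rV[R]_(res_rank F i)) : Prop :=
  exists v, u = v *m res_diff F i.

Lemma aug_diff (u : 'rV[R]_(res_rank F 1)) : u *m res_diff F 0 *m res_aug F = 0.
Proof. by apply/res_aug_exact; exists u. Qed.

Lemma diff_diff i (u : 'rV[R]_(res_rank F i.+2)) :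
  u *m res_diff F i.+1 *m res_diff F i = 0.
Proof. by apply/res_diff_exact; exists u. Qed.

Lemma scaleX_eq0 p q (w : 'X_{1..n}) (A : 'M[R]_(p, q)) : 'X_[w] *: A = 0 -> A = 0.
Proof.
move=> XA; apply/matrixP => i j; move/matrixP/(_ i j): XA; rewrite !mxE.
by move/eqP; rewrite mulf_eq0 -msupp_eq0 msuppX => /eqP.
Qed.

(** The cokernel of [res_diff F i] embeds in a free module, so it is torsion free. *)
Lemma boundary_scaleX i w (f : 'rV[R]_(res_rank F i)) :
  boundary ('X_[w] *: f) -> boundary f.
Proof.
case: i f => [|i] f [v vE].
  apply/res_aug_exact; apply: (@scaleX_eq0 _ _ w).
  by rewrite scalemxAl vE aug_diff.
apply/res_diff_exact; apply: (@scaleX_eq0 _ _ w).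
by rewrite scalemxAl vE diff_diff.
Qed.

Lemma bd_mulmx p q (A : 'M[R]_(p, q)) (g : seq 'I_n -> 'rV[R]_p) s :
  bd (fun t => g t *m A) s = bd g s *m A.
Proof.
elim: s g => [|w s IH] g /=; first by rewrite !subr0 mulmx_suml.
by rewrite IH mulmxBl mulmx_suml.
Qed.

Lemma chain_sub r (g h : seq 'I_n -> 'rV[R]_r) :
  chain g -> chain h -> chain (fun s => g s - h s).
Proof.
by move=> cg ch s; have [f ->] := cg s; have [f' ->] := ch s; exists (f - f'); rewrite scalerBr.
Qed.

Lemma chain_mulmx p q (A : 'M[R]_(p, q)) (g : seq 'I_n -> 'rV[R]_p) :
  chain g -> chain (fun s => g s *m A).
Proof. by move=> cg s; have [f ->] := cg s; exists (f *m A); rewrite scalemxAl. Qed.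

Lemma chain_coef0 r (g : seq 'I_n -> 'rV[R]_r) s k :
  chain g -> (0 < size s)%N -> (g s 0 k)@_0%MM = 0.
Proof.
move=> cg; case: s => // v s _; have [f ->] := cg (v :: s).
rewrite mxE; apply: memN_msupp_eq0; apply/negP => m0.
have /divisible_byP/(_ _ m0)/mnm_seq_le/(_ v (mem_head _ _)) :
  exists f', 'X_[mnm_seq (v :: s)] * f 0 k = 'X_[mnm_seq (v :: s)] * f' by exists (f 0 k).
by rewrite mnm0E.
Qed.

Lemma homog_row_bd N r (sh : 'I_r -> nat) (g : seq 'I_n -> 'rV[R]_r) s :
  (forall t, homog_row N sh (g t)) -> homog_row N sh (bd g s).
Proof.
move=> hg; apply: (bd_closed (P := homog_row N sh)) => //.
- move=> k; rewrite mxE /homog_of_degree_diff; case: ifP => // _; exact: dhomog0.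
- move=> x y hx hy k; have := hx k; have := hy k; rewrite mxE /homog_of_degree_diff.
  by case: ifP => [_|_ -> ->]; [move=> ? ?; exact: dhomogD | rewrite addr0].
- move=> x hx k; have := hx k; rewrite mxE /homog_of_degree_diff.
  by case: ifP => [_|_ ->]; [rewrite dhomogN | rewrite oppr0].
Qed.

(** The lifts are chosen one simplex at a time: the values off length [q] may be taken
    to be zero. *)
Lemma chain_lift N q p r (shP : 'I_p -> nat) (shR : 'I_r -> nat) (A : 'M[R]_(p, r))
    (g : seq 'I_n -> 'rV[R]_r) :
  (forall k l, homog_of_degree_diff (shP k) (shR l) (A k l)) ->
  (forall s, homog_row N shR (g s)) ->
  (forall s, size s = q ->
     exists2 f, g s = 'X_[mnm_seq s] *: f & exists v, f = v *m A) ->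
  exists h : seq 'I_n -> 'rV[R]_p,
    [/\ chain h, forall s, homog_row N shP (h s) & forall s, size s = q -> g s = h s *m A].
Proof.
move=> hA hg gA.
have [|h hP] := @functional_choice_on _ _ (fun s : seq 'I_n => size s = q)
  (fun s h => [/\ homog_row N shP h, exists f, h = 'X_[mnm_seq s] *: f & g s = h *m A]) 0.
  move=> s /gA[f gsE [v fE]]; rewrite gsE.
  by apply: homog_row_lift hA _ fE; rewrite -gsE.
exists (fun s => if size s == q then h s else 0); split=> s.
- by case: eqP => [/hP[]//|_]; exists 0; rewrite scaler0.
- case: eqP => [/hP[]//|_] k; rewrite mxE /homog_of_degree_diff.
  by case: ifP => // _; exact: dhomog0.
by move=> sq; rewrite sq eqxx; case: (hP s sq).
Qed.

(** Vanishing of [Tor_q] of the cokernel of [res_diff F i] in degrees above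
    [d + i + q], by dimension shifting. If [q > 0], lift [bd a] to a chain [a'] in
    [F_{i+1}] and write it as [bd b' + c' d] by induction; then [a - b' d] is a cycle
    of the simplex resolution, hence a boundary. If [q = 0], the coefficients of
    [a] have positive degree, since those of the basis of [F_i] are at
    most [d + i]. *)
Lemma zigzag q i N (a : seq 'I_n -> 'rV[R]_(res_rank F i)) :
  chain a -> (forall s, homog_row N (@res_shift _ _ _ F i) (a s)) ->
  (d + i + q < N)%N -> (forall s, (size s).+1 = q -> boundary (bd a s)) ->
  exists b c, [/\ chain b, chain c &
    forall s, size s = q -> a s = bd b s + c s *m res_diff F i].
Proof.
elim: q i a => [|q IH] i a ca ha ltN bda.
  have [s k|//|b cb bE] := @chain_exact K n _ a 0%N ca.
    move=> _; have := ha s k; rewrite /homog_of_degree_diff.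
    have := linF k; case: (leqP (res_shift k) N) => [lkN lk hk|_ _ ->]; last by rewrite mcoeff0.
    by apply: dhomog_nemf_coeff hk _; rewrite /= mdeg0; lia.
  exists b, (fun _ => 0); split=> //; first by move=> s; exists 0; rewrite scaler0.
  by move=> s /bE->; rewrite mul0mx addr0.
have [||s sq|a' [ca' ha' a'E]] :=
    @chain_lift N q _ _ (@res_shift _ _ _ F i.+1) (@res_shift _ _ _ F i)
      (res_diff F i) (bd a).
- exact: res_diff_homog.
- by move=> s; exact: homog_row_bd.
- have [f fE] := chain_bd ca s; exists f => //.
  apply: (boundary_scaleX (w := mnm_seq s)).
  by rewrite -fE; apply: bda; rewrite sq.
have [|s sq|b' [c' [cb' cc' b'E]]] := IH i.+1 a' ca' ha'.
- by lia.
- apply/res_diff_exact; rewrite -bd_mulmx.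
  rewrite (bd_ext (g' := bd a)) ?bd_bd // => t _ st.
  by rewrite -a'E // st.
have [||s sq|b cb bE] := @chain_exact K n _ (fun s => a s - b' s *m res_diff F i) q.+1.
- exact: chain_sub ca (chain_mulmx _ cb').
- move=> s k sq; apply: (@chain_coef0 _ (fun s => a s - b' s *m res_diff F i)); last by rewrite sq.
  exact: chain_sub ca (chain_mulmx _ cb').
- have {}sq : size s = q by case: sq.
  by rewrite bdB bd_mulmx a'E // b'E // mulmxDl diff_diff addr0 subrr.
exists b, b'; split=> // s sq.
by rewrite bE // subrK.
Qed.

(** This is the vanishing of [Tor_{q+1}(R/I, K)] in degree [N > d + q]: a chain that
    is a cycle modulo [I] is a boundary modulo [I]. *)
Lemma linear_tor_vanishing q N (z : seq 'I_n -> 'rV[R]_1) :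
  chain z -> (forall s, homog_row N (fun _ => 0%N) (z s)) -> (d + q < N)%N ->
  (forall s, size s = q -> exists2 f, bd z s = 'X_[mnm_seq s] *: f & I (f 0 0)) ->
  exists y : seq 'I_n -> 'rV[R]_1, chain y /\
    forall s, size s = q.+1 ->
      exists2 f, z s = bd y s + 'X_[mnm_seq s] *: f & I (f 0 0).
Proof.
move=> cz hz ltN bdz.
have IE (f : 'rV_1) : I (f 0 0) <-> exists v, f = v *m res_aug F.
  rewrite (res_aug_image F); split=> -[v vE]; exists v; last by rewrite vE.
  by apply/matrixP => i j; rewrite !ord1.
have [||s sq|a [ca ha aE]] :=
    @chain_lift N q _ _ (@res_shift _ _ _ F 0) (fun _ => 0%N) (res_aug F) (bd z).
- by move=> k l; rewrite ord1 /homog_of_degree_diff /= subn0; exact: res_aug_homog.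
- by move=> s; exact: homog_row_bd.
- by have [f fE If] := bdz s sq; exists f => //; apply/IE.
have [|s sq|b [c [cb cc bE]]] := @zigzag q 0%N N a ca ha.
- by rewrite addn0.
- apply/res_aug_exact; rewrite -bd_mulmx.
  rewrite (bd_ext (g' := bd z)) ?bd_bd // => t _ st.
  by rewrite -aE // st.
have cza : chain (fun s => z s - b s *m res_aug F).
  exact: chain_sub cz (chain_mulmx _ cb).
have [s k sq|s [sq]|y cy yE] := @chain_exact K n _ _ q.+1 cza.
- by apply: (chain_coef0 _ cza); rewrite sq.
- by rewrite bdB bd_mulmx aE // bE // mulmxDl aug_diff addr0 subrr.
exists y; split=> // s sq; have [f fE] := cb s.
exists (f *m res_aug F); last by apply/IE; exists f.
by rewrite yE // scalemxAl -fE subrK.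
Qed.

End Resolution.
End ZigZag.

(** * The cocycle of a cycle *)

Section Cochains.
Variables (I : finType) (K : fieldType).
Implicit Types (f g : seq I -> K) (s t : seq I).

(** The transpose of [bd], see [cobd_adjoint] and, for the usual formula, [cobdE]. *)
Fixpoint cobd f t : K :=
  if t is w :: s then f s - cobd (fun t => f (w :: t)) s else 0.

Fixpoint seq_sum k f : K :=
  if k is k'.+1 then \sum_v seq_sum k' (fun s => f (v :: s)) else f [::].

Lemma eq_seq_sum k f g : (forall s, size s = k -> f s = g s) -> seq_sum k f = seq_sum k g.
Proof.
elim: k f g => [|k IH] f g fg /=; first exact: fg.
by apply: eq_bigr => v _; apply: IH => s sk; apply: fg; rewrite /= sk.
Qed.

Lemma seq_sumD k f g : seq_sum k (fun s => f s + g s) = seq_sum k f + seq_sum k g.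
Proof.
elim: k f g => //= k IH f g; rewrite -big_split /=.
by apply: eq_bigr => v _; rewrite IH.
Qed.

Lemma seq_sumN k f : seq_sum k (fun s => - f s) = - seq_sum k f.
Proof. by elim: k f => //= k IH f; rewrite -sumrN; apply: eq_bigr. Qed.

Lemma seq_sumB k f g : seq_sum k (fun s => f s - g s) = seq_sum k f - seq_sum k g.
Proof. by rewrite seq_sumD seq_sumN. Qed.

Lemma seq_sum_sum (J : finType) k (f : J -> seq I -> K) :
  seq_sum k (fun s => \sum_j f j s) = \sum_j seq_sum k (f j).
Proof.
elim: k f => //= k IH f; rewrite exchange_big /=.
by apply: eq_bigr => v _; rewrite IH.
Qed.

Lemma seq_sum0 k f : (forall s, size s = k -> f s = 0) -> seq_sum k f = 0.
Proof.
elim: k f => [|k IH] f f0 /=; first exact: f0.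
by apply: big1 => v _; apply: IH => s sk; apply: f0; rewrite /= sk.
Qed.

Lemma seq_sum_pred1 f s0 :
  seq_sum (size s0) (fun s => if s == s0 then f s else 0) = f s0.
Proof.
elim: s0 f => [|v s0 IH] f //=.
rewrite (bigD1 v) //= big1 ?addr0 => [|w wv].
  rewrite -[RHS](IH (fun s => f (v :: s))); apply: eq_seq_sum => s _.
  by rewrite eqseq_cons eqxx.
by apply: seq_sum0 => s _; rewrite eqseq_cons (negbTE wv).
Qed.

Lemma cobd_adjoint k f g :
  seq_sum k (fun s => f s * bd g s) = seq_sum k.+1 (fun t => cobd f t * g t).
Proof.
elim: k f g => [|k IH] f g.
  by rewrite /= subr0 mulr_sumr; apply: eq_bigr => v _; rewrite subr0.
transitivity (\sum_w (seq_sum k (fun s => \sum_v f (w :: s) * g [:: v, w & s])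
   - seq_sum k (fun s => f (w :: s) * bd (fun t => g (w :: t)) s))).
  apply: eq_bigr => w _; rewrite -seq_sumB; apply: eq_seq_sum => s _.
  by rewrite /= mulrBr mulr_sumr.
transitivity (\sum_v (seq_sum k.+1 (fun t => f t * g (v :: t))
   - seq_sum k.+1 (fun t => cobd (fun s => f (v :: s)) t * g (v :: t)))).
  rewrite !sumrB; congr (_ - _); last by apply: eq_bigr => w _; rewrite IH.
  rewrite [RHS]exchange_big /=; apply: eq_bigr => w _.
  exact: (seq_sum_sum k (fun v s => f (w :: s) * g [:: v, w & s])).
change (seq_sum k.+2 (fun t => cobd f t * g t)) with
  (\sum_v seq_sum k.+1 (fun t => cobd f (v :: t) * g (v :: t))).
apply: eq_bigr => v _; rewrite -seq_sumB; apply: eq_seq_sum => t _.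
by rewrite /= mulrBl.
Qed.

Lemma cobd_sum (J : Type) (r : seq J) (f : J -> seq I -> K) t :
  cobd (fun s => \sum_(j <- r) f j s) t = \sum_(j <- r) cobd (f j) t.
Proof.
elim: t f => [|w s IH] f /=; first by rewrite big1.
by rewrite IH -sumrB.
Qed.

Lemma cobdE f t :
  cobd f t = \sum_(j < size t) (-1) ^+ j * f (take j t ++ drop j.+1 t).
Proof.
elim: t f => [|w s IH] f /=; first by rewrite big_ord0.
rewrite big_ord_recl /= expr0 mul1r drop0 IH; congr (_ + _).
rewrite -sumrN; apply: eq_bigr => j _.
by rewrite /bump /= add1n exprS mulN1r mulNr.
Qed.

End Cochains.

Section Volume.
Variables (I : finType) (K : fieldType) (x0 : I) (c : seq I).
Hypothesis c_uniq : uniq c.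
Local Notation l := (size c).

(** The sign of the permutation that carries [c] to [t], or 0 if [t] is not a
    rearrangement of [c]. *)
Definition volume (t : seq I) : K :=
  \det (\matrix_(i < l, j < l) (nth x0 t i == nth x0 c j)%:R : 'M[K]_l).

Lemma volume_self : volume c = 1.
Proof.
rewrite /volume -[RHS](det1 _ l); congr (\det _); apply/matrixP => i j.
by rewrite !mxE nth_uniq.
Qed.

Lemma volume_neq0 t : size t = l -> volume t != 0 -> perm_eq t c.
Proof.
move=> st v0.
have ut : uniq t.
  apply: contraNT v0 => /(uniqPn x0)[i [j [ij jt tij]]].
  have jl : (j < l)%N by rewrite -st.
  have il : (i < l)%N := ltn_trans ij jl.
  apply/eqP; apply: (@determinant_alternate _ _ _ (Ordinal il) (Ordinal jl)).
    by rewrite -val_eqE /= ltn_eqF.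
  by move=> k; rewrite !mxE /= tij.
have tc : {subset t <= c}.
  move=> x xt; apply: contraNT v0 => xc.
  have il : (index x t < l)%N by rewrite -st index_mem.
  apply/eqP; rewrite /volume (expand_det_row _ (Ordinal il)) big1 // => j _.
  rewrite mxE /= nth_index //; case: eqP => [xj|]; last by rewrite mul0r.
  by case/negP: xc; rewrite xj mem_nth.
have [_ tcE] := uniq_min_size ut tc (eq_leq (esym st)).
exact: uniq_perm.
Qed.

(** A matrix whose first column is the sum of the others is singular; expand it
    along that column. *)
Lemma cobd_volume t : size t = l.+1 -> {subset t <= c} -> cobd volume t = 0.
Proof.
move=> st tc; rewrite cobdE st.
(* the column of ones stands first, at [ord0] *)
pose B : 'M[K]_l.+1 := \matrix_(i, j)
  if unlift ord0 j is Some k then (nth x0 t i == nth x0 c k)%:R else 1.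
have detB : \det B = 0.
  apply/eqP; rewrite -det_tr; apply/det0P.
  exists (\row_j (if j == ord0 then 1 else -1)).
    by apply/eqP => /rowP/(_ ord0); rewrite !mxE eqxx => /eqP; rewrite oner_eq0.
  apply/rowP => i; rewrite !mxE big_ord_recl !mxE eqxx unlift_none mul1r.
  have ti : nth x0 t i \in c by apply/tc/mem_nth; rewrite st.
  have jl : (index (nth x0 t i) c < l)%N by rewrite index_mem.
  rewrite (bigD1 (Ordinal jl)) //= !mxE liftK /= nth_index // eqxx mulr1.
  rewrite big1 ?addr0 ?subrr // => j jN; rewrite !mxE liftK.
  case: (nth x0 t i =P _) => [e|_]; last by rewrite mulr0.
  by case/eqP: jN; apply: val_inj; rewrite /= e index_uniq.
rewrite -[RHS]detB (expand_det_col _ ord0); apply: eq_bigr => j _.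
rewrite mxE unlift_none mul1r /cofactor addn0; congr (_ * \det _).
apply/matrixP => i k; rewrite !mxE liftK; congr ((_ == _)%:R).
have jt : (j <= size t)%N by rewrite st ltnW.
rewrite nth_cat size_takel // /= /bump; case: leqP => ji.
  by rewrite nth_drop addSn subnKC.
by rewrite nth_take.
Qed.

(** The sum of the edges of the cycle, turned by the volume form into a cochain on
    the complements of edges (Alexander duality). *)
Definition cycle_cochain (s : seq I) : K :=
  \sum_(v <- c) volume [:: v, next c v & s].

(** By [cobd_volume], the coboundary of the term of an edge is the difference of the
    terms of its endpoints; around a cycle these differences add up to zero. *)
Lemma cobd_cycle_cochain t : size t = l.-1 -> (0 < l)%N -> {subset t <= c} ->
  cobd cycle_cochain t = 0.
Proof.
move=> st l0 tc; rewrite cobd_sum.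
transitivity (\sum_(v <- c) (volume (v :: t) - volume (next c v :: t))).
  rewrite big_seq [RHS]big_seq; apply: eq_bigr => v cv.
  have : cobd volume [:: v, next c v & t] = 0.
    apply: cobd_volume => [|x]; first by rewrite /= st prednK.
    by rewrite !inE => /or3P[/eqP->|/eqP->|/tc]; rewrite ?mem_next.
  by rewrite /= opprB addrCA => /eqP; rewrite addr_eq0 opprB => /eqP.
have perm_next : perm_eq [seq next c v | v <- c] c.
  apply: uniq_perm => [||v] //.
    by rewrite map_inj_uniq //; exact: (can_inj (prev_next c_uniq)).
  apply/mapP/idP => [[w cw ->]|cv]; first by rewrite mem_next.
  by exists (prev c v); rewrite ?mem_prev // next_prev.
rewrite sumrB -(big_map (next c) predT (fun w => volume (w :: t))).
by rewrite (perm_big _ perm_next) subrr.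
Qed.

Lemma cycle_cochain_neq0 s : size s = l.-2 -> (1 < l)%N -> cycle_cochain s != 0 ->
  exists2 v, v \in c & perm_eq [:: v, next c v & s] c.
Proof.
move=> ss l1 nz.
have [/hasP[v cv nzv]|/hasPn z] := boolP (has (fun v => volume [:: v, next c v & s] != 0) c).
  by exists v => //; apply: volume_neq0 nzv; rewrite /= ss; lia.
case/eqP: nz; rewrite /cycle_cochain big_seq big1 // => v /z.
by rewrite negbK => /eqP.
Qed.

End Volume.

Lemma cycle_cochain_drop (I : finType) (K : fieldType) (x0 : I) (c : seq I) :
  uniq c -> (2 < size c)%N -> cycle_cochain K x0 c (drop 2 c) = 1.
Proof.
case: c => [|a [|b [|e s]]] // uc _; set c := [:: a, b, e & s].
have ba : (b == a) = false by move: uc; rewrite /= !inE eq_sym => /andP[/norP[/negbTE-> _]].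
rewrite /cycle_cochain big_cons [next c a]/= eqxx volume_self // big_seq big1 ?addr0 //.
move=> v; rewrite -/(drop 1 c) => cv.
apply/eqP; apply: contraTT (uc) => nz.
have /perm_uniq <- : perm_eq [:: v, next c v & drop 2 c] c.
  by apply: volume_neq0 nz; rewrite //= .
rewrite /= !inE; move: cv; rewrite /= !inE.
case/or3P=> [/eqP->|->|->]; rewrite ?orbT ?andbF //=.
by rewrite ba !eqxx /= andbF.
Qed.

(** * Induced cycles obstruct linear resolutions *)

Section Obstruction.
Variables (K : fieldType) (n : nat).
Local Notation R := {mpoly K[n]}.

Lemma mdeg_mnm_seq (c : seq 'I_n) : uniq c -> mdeg (mnm_seq c) = size c.
Proof.
move=> uc; rewrite mdegE -(card_uniqP uc) -sum1_card [RHS]big_mkcond /=.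
by apply: eq_bigr => v _; rewrite mnmE; case: (v \in c).
Qed.

Lemma mnm_seq_perm (s t : seq 'I_n) : s =i t -> mnm_seq s = mnm_seq t.
Proof. by move=> st; apply/mnmP => v; rewrite !mnmE st. Qed.

Lemma mnm_seq_cons v (s : seq 'I_n) : v \notin s ->
  mnm_seq (v :: s) = (U_(v) + mnm_seq s)%MM.
Proof.
move=> vs; apply/mnmP => u; rewrite mnmDE mnm1E !mnmE inE eq_sym.
by case: eqP => //= <-; rewrite (negbTE vs).
Qed.

Lemma exists_disjoint_subset (T : eqType) (s c : seq T) : uniq c -> {subset s <= c} ->
  forall k, (size s + k <= size c)%N ->
  exists r, [/\ size r = k, uniq r, {subset r <= c} & ~~ has (mem s) r].
Proof.
move=> uc sc k le; exists (take k [seq x <- c | x \notin s]); split.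
- apply: size_takel; rewrite size_filter (eq_count (a2 := predC (mem s))) //.
  rewrite -(leq_add2l (count (mem s) c)) count_predC.
  apply: leq_trans le; rewrite leq_add2r -size_filter.
  apply: uniq_leq_size; first exact: filter_uniq.
  by move=> x; rewrite mem_filter => /andP[].
- exact/take_uniq/filter_uniq.
- by move=> x /mem_take; rewrite mem_filter => /andP[].
by apply/hasPn => x /mem_take; rewrite mem_filter => /andP[].
Qed.

Lemma mnm_seq_sub (g : 'X_{1..n}) (q s c : seq 'I_n) :
  {subset s <= c} -> {subset q <= c} -> ~~ has (mem s) q ->
  (g + mnm_seq q <= g + mnm_seq c - mnm_seq s)%MM.
Proof.
move=> sc qc /hasPn qs; apply/mnm_lepP => i; rewrite mnmBE !mnmDE !mnmE.
case: (boolP (i \in q)) => [iq|_] /=; last first.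
  by case: (boolP (i \in s)) => [/sc->|_]; rewrite addn0 ?addnK ?subn0 ?leq_addr.
have /negbTE is_ : i \notin s := qs i iq.
by rewrite (qc _ iq) is_ subn0.
Qed.

Lemma mnm_seq3 (g : 'X_{1..n}) u v w : uniq [:: u; v; w] ->
  (g + mnm_seq [:: u; v; w] = g + U_(u) + U_(v) + U_(w))%MM.
Proof.
move=> /and4P[nu nv nw _]; rewrite !mnm_seq_cons // !addmA.
by rewrite [mnm_seq [::]](_ : _ = 0%MM) ?addm0 //; apply/mnmP => i; rewrite !mnmE.
Qed.

(** In the multidegree [a] of [x ^ g] times the product of the cycle, a simplex [s] on the
    vertices of [c] contributes to [Tor(R/J, K)] only if [x ^ (a - s)] is not
    in [J]. By hypothesis this holds when [s] is the complement of an edge of the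
    cycle and fails when [s] omits at least three vertices. Hence the complement of
    a single edge is a cycle modulo [J]. Its degree is too large for a [d]-linear
    [J], unless it is a boundary modulo [J]; but [cycle_cochain] vanishes on
    boundaries and takes the value 1 on it. *)
Theorem cycle_obstruction d (J : R -> Prop) (M : 'X_{1..n} -> Prop)
    (c : seq 'I_n) (g : 'X_{1..n}) :
  eq_ideal J (span (monomials M)) -> uniq c -> (2 < size c)%N ->
  (mdeg g + 2)%N = d -> (forall v, (0 < g v)%N -> v \in c) ->
  {in c, forall v, ~ multiple M (g + U_(v) + U_(next c v))%MM} ->
  {in c & &, forall u v w, uniq [:: u; v; w] ->
     multiple M (g + U_(u) + U_(v) + U_(w))%MM} ->
  linear_resolution d J -> False.
Proof.
move=> JM uc c3 dg gc edges triples.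
have x0 : 'I_n by case: (c) c3.
have [//|//|r [/eqP r3 ur rc _]] := @exists_disjoint_subset _ [::] c uc _ 3.
case=> [J0|[F [linF _]]].
  case: r r3 ur rc => [|u [|v [|w [|? ?]]]] // _ ur rc.
  have : J 'X_[g + U_(u) + U_(v) + U_(w)].
    apply/JM/mem_spanX; apply: triples => //; apply: rc; rewrite !inE eqxx ?orbT //.
  by move/J0/eqP; rewrite -msupp_eq0 msuppX.
pose a := (g + mnm_seq c)%MM.
have ca : (mnm_seq c <= a)%MM by rewrite /a addmC lepm_addr.
(* the complement of the edge between the first two vertices of [c] *)
pose s0 := drop 2 c.
have s0c : {subset s0 <= c} by move=> x; exact: mem_drop.
have le_sub (s t : seq 'I_n) : {subset s <= t} -> (mnm_seq s <= mnm_seq t)%MM.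
  by move=> st; apply/mnm_seq_le => v /st vt; rewrite mnmE vt.
pose z (s : seq 'I_n) : 'rV[R]_1 := if s == s0 then 'X_[a]%:M else 0.
have sz0 : size s0 = (size c - 3).+1 by rewrite size_drop; lia.
have da : mdeg a = (mdeg g + size c)%N by rewrite mdegD mdeg_mnm_seq.
(* a face of [s0] of size [size c - 3] omits three vertices of [c] *)
have zE (s t : seq 'I_n) : {subset s <= t} -> size s = (size c - 3)%N ->
    exists2 f : 'rV_1, z t = 'X_[mnm_seq s] *: f & J (f 0 0).
  move=> st ss; rewrite /z; case: eqP => [ts|_]; last first.
    by exists 0; rewrite ?scaler0 // mxE; apply/JM; exact: span0.
  have sc : {subset s <= c} by move=> x /st; rewrite ts => /s0c.
  have sa : (mnm_seq s <= a)%MM by apply: lepm_trans ca; exact: le_sub.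
  exists 'X_[a - mnm_seq s]%:M.
    by rewrite scale_scalar_mx -mpolyXD addmC submK.
  rewrite mxE eqxx; apply/JM/mem_spanX.
  have [|q [/eqP q3 uq qc qs]] := @exists_disjoint_subset _ s c uc sc 3; first by rewrite ss subnK.
  have le_q := mnm_seq_sub g sc qc qs; apply: multiple_le le_q.
  case: q q3 uq qc qs => [|u [|v [|w [|? ?]]]] // _ uq qc _; rewrite mnm_seq3 //.
  by apply: triples => //; apply: qc; rewrite !inE eqxx ?orbT.
have cz : chain z.
  move=> s; rewrite /z; case: eqP => [->|_]; last by exists 0; rewrite scaler0.
  exists 'X_[a - mnm_seq s0]%:M; rewrite scale_scalar_mx -mpolyXD addmC submK //.
  by apply: lepm_trans ca; exact: le_sub.
have hz s : homog_row (mdeg a) (fun _ => 0%N) (z s).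
  move=> k; rewrite /homog_of_degree_diff /= subn0 /z !ord1.
  case: eqP => _; rewrite mxE; last exact: dhomog0.
  by rewrite eqxx dhomogX; apply/eqP.
have [||y [cy yE]] := @linear_tor_vanishing K n d J F linF (size c - 3) (mdeg a) z cz hz.
- by rewrite da -dg; lia.
- move=> s ss; apply: (bd_closed (P := fun x : 'rV_1 =>
    exists2 f : 'rV_1, x = 'X_[mnm_seq s] *: f & J (f 0 0))).
  + by exists 0; rewrite ?scaler0 // mxE; apply/JM; exact: span0.
  + move=> _ _ [f -> /JM Jf] [f' -> /JM Jf']; exists (f + f'); rewrite ?scalerDr //.
    by rewrite mxE; apply/JM; exact: spanD.
  + move=> _ [f -> /JM Jf]; exists (- f); rewrite ?scalerN //.
    by rewrite mxE -mulN1r; apply/JM; exact: spanM.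
  + by move=> t st; exact: zE.
(* pair the multidegree [a] part of this equality with the cocycle of [c] *)
pose psi := cycle_cochain K x0 c.
pose ya s : K := (y s 0 0)@_a.
have eqs : seq_sum (size s0) (fun s => psi s * (z s 0 0)@_a) =
           seq_sum (size s0) (fun s => psi s * bd ya s).
  apply: eq_seq_sum => s ss.
  have [f -> Jf] := yE s (etrans ss sz0).
  rewrite mxE mcoeffD mulrDr.
  have -> : (bd y s 0 0)@_a = bd ya s.
    apply: (bd_morph (f := fun u : 'rV[R]_1 => (u 0 0)@_a)) => u v.
    by rewrite !mxE mcoeffB.
  rewrite -[RHS]addr0; congr (_ + _); rewrite mxE.
  have [->|psi0] := eqVneq (psi s) 0; first by rewrite mul0r.
  have [||v cv vsc] := cycle_cochain_neq0 uc _ _ psi0; first by rewrite ss size_drop subn2.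
    exact: ltnW.
  have [vN wN us] : [/\ v \notin next c v :: s, next c v \notin s & uniq s].
    by move: uc; rewrite -(perm_uniq vsc) => /and3P[].
  have aE : a = (mnm_seq s + (g + U_(v) + U_(next c v)))%MM.
    rewrite /a -(mnm_seq_perm (perm_mem vsc)) !mnm_seq_cons //.
    by rewrite [RHS]addmC !addmA.
  rewrite aE [_ * f 0 0]mulrC mcoeffMX memN_msupp_eq0 ?mulr0 //; apply/negP => fm.
  have /JM/mem_spanM/(_ _ fm) := Jf; exact: edges.
have : psi s0 = 0.
  transitivity (seq_sum (size s0) (fun s => psi s * (z s 0 0)@_a)).
    rewrite -[LHS](seq_sum_pred1 psi s0); apply: eq_seq_sum => s _; rewrite /z.
    by case: eqP => _; rewrite !mxE ?eqxx ?mcoeffX ?eqxx ?mcoeff0 ?mulr1 ?mulr0.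
  rewrite eqs cobd_adjoint; apply: seq_sum0 => t st.
  have [tc|/subsetPn[v tv cNv]] := boolP (t \subset c).
    rewrite cobd_cycle_cochain ?mul0r //; last exact/subsetP.
      by rewrite st sz0; case: (size c) c3 => [|[|[|k]]] // _; rewrite !subSS subn0.
    exact: ltn_trans c3.
  rewrite [ya t](_ : _ = 0) ?mulr0 // /ya; have [f ->] := cy t; rewrite mxE.
  apply: memN_msupp_eq0; apply/negP => am.
  have /divisible_byP/(_ _ am)/mnm_seq_le/(_ v tv) :
    exists h, 'X_[mnm_seq t] * f 0 0 = 'X_[mnm_seq t] * h by exists (f 0 0).
  rewrite mnmDE mnmE (negbTE cNv) addn0 => /gc.
  by rewrite (negbTE cNv).
by rewrite /psi /s0 cycle_cochain_drop // => /eqP; rewrite oner_eq0.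
Qed.

End Obstruction.

(** * Vertex splittings of monomial ideals *)

Section Splitting.
Variables (K : fieldType) (n : nat).
Local Notation R := {mpoly K[n]}.
Implicit Types (X Y U : {set 'I_n}) (M : 'X_{1..n} -> Prop) (m : 'X_{1..n}).
Implicit Types (u v x y : 'I_n).

Definition antichain M : Prop := forall m m', M m -> M m' -> (m <= m')%MM -> m = m'.

Lemma sum_ideal_span X (I J : R -> Prop) M1 M2 M :
  eq_ideal I (span_in X (monomials M1)) -> eq_ideal J (span_in X (monomials M2)) ->
  (forall m, M m <-> M1 m \/ M2 m) ->
  eq_ideal (span_in X (monomials M)) (sum_ideal I J).
Proof.
move=> IM JM ME f; split.
  case=> s Hs ->; elim: s Hs => [|c s IHs] Hs.
    exists 0, 0; rewrite big_nil addr0; split=> //; [apply/IM | apply/JM]; exact: span_in0.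
  have [|g [h [/IM Ig /JM Jh sE]]] := IHs; first by move=> d ds; apply: Hs; rewrite inE ds orbT.
  have [Xc [m /ME Mm c2]] := Hs c (mem_head _ _); rewrite big_cons sE.
  have Mc (M' : 'X_{1..n} -> Prop) : M' m -> span_in X (monomials M') (c.1 * c.2).
    by move=> M'm; apply: span_inM => //; apply: mem_span_in; exists m.
  case: Mm => /Mc Mc'.
    exists (c.1 * c.2 + g), h; rewrite addrA; split=> //; last exact/JM.
    by apply/IM; exact: span_inD.
  exists g, (c.1 * c.2 + h); rewrite addrCA; split=> //; first exact/IM.
  by apply/JM; exact: span_inD.
case=> g [h [/IM Ig /JM Jh ->]]; apply: span_inD.
  by apply: span_in_min Ig => // _ [m Mm ->]; apply: mem_span_in; exists m => //; apply/ME; left.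
by apply: span_in_min Jh => // _ [m Mm ->]; apply: mem_span_in; exists m => //; apply/ME; right.
Qed.

Lemma vertex_splittable_eq X (I J : R -> Prop) :
  eq_ideal I J -> vertex_splittable_in X J -> vertex_splittable_in X I.
Proof.
move=> IJ vsJ; case: vsJ IJ => {X J}.
- by move=> X J v Xv Jv IJ; apply: (VSMonomial Xv) => f; rewrite IJ.
- by move=> X J J0 IJ; apply: VSZero => f; rewrite IJ.
- by move=> X J JX IJ; apply: VSFull => f; rewrite IJ.
move=> X J x I1 I2 M1 M2 xX vs1 vs2 JE I21 gens1 gens2 disj [JM Jmin] IJ.
apply: (VSSplit xX vs1 vs2 _ I21 gens1 gens2 disj) => [f|]; first by rewrite IJ.
split=> [f|M' M'M IM']; first by rewrite IJ.
by apply: Jmin => // f; rewrite -IJ.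
Qed.

(** For ideals given by monomials, all conditions on a vertex splitting reduce to
    divisibility. *)
Lemma vertex_splittable_split X x M1 M2 M : x \in X ->
  (forall m, M1 m -> mnm_in (X :\ x) m) -> (forall m, M2 m -> mnm_in (X :\ x) m) ->
  vertex_splittable_in (X :\ x) (span_in (X :\ x) (monomials M1) : R -> Prop) ->
  vertex_splittable_in (X :\ x) (span_in (X :\ x) (monomials M2) : R -> Prop) ->
  (forall m, M2 m -> multiple M1 m) ->
  (forall m, M m <-> (exists2 m', M1 m' & m = (U_(x) + m')%MM) \/ M2 m) ->
  antichain M ->
  vertex_splittable_in X (span_in X (monomials M) : R -> Prop).
Proof.
move=> xX XM1 XM2 vs1 vs2 M21 ME anti.
have subX : X :\ x \subset X := subD1set _ _.
pose M1x m := exists2 m', M1 m' & m = (U_(x) + m')%MM.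
pose I1 : R -> Prop := span_in (X :\ x) (monomials M1).
pose I2 : R -> Prop := span_in (X :\ x) (monomials M2).
have I1E : eq_ideal (mulX_ideal X x I1) (span_in X (monomials M1x)).
  exact: (@mulX_ideal_monomials K n X x M1 I1 (fun f => iff_refl _)).
have I2E : eq_ideal (span_in X I2) (span_in X (monomials M2)).
  exact: (@span_in_span K n X _ M2 I2 subX (fun f => iff_refl _)).
have XM1x m : M1x m -> mnm_in X m.
  case=> m' /XM1 Xm' ->; rewrite mnm_inD mnm_in1 xX.
  exact: mnm_in_sub Xm'.
have XM2' m : M2 m -> mnm_in X m by move/XM2; exact: mnm_in_sub.
have XM m : M m -> mnm_in X m by case/ME => [/XM1x|/XM2'].
apply: (VSSplit xX vs1 vs2 (M1 := M1x) (M2 := M2)).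
- exact: (sum_ideal_span I1E I2E ME).
- move=> f; apply: span_in_min => // _ [m M2m ->]; apply/mem_span_inX => //; first exact: XM2.
  exact: M21.
- apply/min_gensP => //; split=> // m m' M1m M1m'.
  by apply: anti; apply/ME; left.
- apply/min_gensP => //; split=> // m m' M2m M2m'.
  by apply: anti; apply/ME; right.
- move=> m [[m' M1m' ->] /XM2/mnm_inP/(_ x)].
  by rewrite mnmDE mnm1E eqxx !inE eqxx => /(_ isT).
apply: (min_gens_ext (M := M)); first exact: ME.
by apply/min_gensP.
Qed.

Lemma vertex_splittable_empty X M : (forall m, ~ M m) ->
  vertex_splittable_in X (span_in X (monomials M) : R -> Prop).
Proof.
move=> M0; apply: VSZero => f; split=> [[[|c s] Hs ->]|->]; last exact: span_in0.
  by rewrite big_nil.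
by have [_ [m /M0]] := Hs c (mem_head _ _).
Qed.

Definition pure_powers U (e : 'I_n -> nat) m := exists2 u, u \in U & m = (U_(u) *+ e u)%MM.

(** Split off the variables of exponent 1, with cofactor the whole ring; what remains
    is at most one power of a variable. *)
Lemma vertex_splittable_pure_powers Y U (e : 'I_n -> nat) : U \subset Y ->
  (forall u, 0 < e u)%N -> {in U &, forall u v, 1 < e u -> 1 < e v -> u = v}%N ->
  vertex_splittable_in Y (span_in Y (monomials (pure_powers U e)) : R -> Prop).
Proof.
move=> UY e0 e1; move k: #|U| => kU.
elim: kU U Y k UY e1 => [|k IH] U Y kU UY e1.
  apply: vertex_splittable_empty => m [u].
  by rewrite (cards0_eq kU) inE.
have [/existsP[u /andP[uU /eqP eu]]|/existsPn e2] := boolP [exists u in U, e u == 1%N].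
  apply: (@vertex_splittable_split _ u (eq 0%MM) (pure_powers (U :\ u) e)).
  - exact: (subsetP UY).
  - by move=> _ <-; apply/mnm_inP => i; rewrite mnm0E.
  - move=> _ [v vU ->]; apply/mnm_inMn; rewrite mnm_in1.
    by apply: subsetP vU; exact: setSD.
  - apply: (@VSMonomial _ _ _ _ 0%MM) => //.
    by apply/mnm_inP => i; rewrite mnm0E.
  - apply: IH; first by move: kU; rewrite (cardsD1 u) uU => -[].
      exact: setSD.
    by move=> v w /setD1P[_ vU] /setD1P[_ wU]; exact: e1.
  - by move=> m _; exists 0%MM => //; apply/mnm_lepP => i; rewrite mnm0E.
  - move=> m; split=> [[v vU ->]|[[_ <- ->]|[v /setD1P[_ vU] ->]]]; last by exists v.
      have [->|vu] := eqVneq v u; first by left; exists 0%MM; rewrite ?eu ?mulm1n ?addm0.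
      by right; exists v => //; apply/setD1P.
    by exists u; rewrite ?eu ?mulm1n ?addm0.
  move=> _ _ [v vU ->] [w wU ->] /mnm_lepP/(_ v).
  rewrite !mulmnE !mnm1E eqxx; case: eqP => [->//|_].
  by have := e0 v; lia.
have [u uU] : exists u, u \in U by apply/card_gt0P; rewrite kU.
have e_gt1 v : v \in U -> (1 < e v)%N.
  by move=> vU; have := e2 v; rewrite vU /=; have := e0 v; lia.
apply: (@VSMonomial _ _ _ _ (U_(u) *+ e u)%MM).
  by apply/mnm_inMn; rewrite mnm_in1 (subsetP UY).
apply: eq_span_in; apply: eq_monomials => m; split=> [[v vU ->]|<-]; last by exists u.
by rewrite (e1 u v) ?e_gt1.
Qed.

End Splitting.

(** If [y] is adjacent in [H] to some vertex of [S], Dirac's theorem for the complement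
    of [H] yields a simplicial vertex [u] among the neighbours of [y]; there the two
    complements agree, because [y] is not a neighbour of [u] in either. Otherwise [y]
    is joined to all of [S] in the complement of [H], and any simplicial vertex
    [u <> y] of the complement of [G] will do. *)
Lemma common_simplicial (T : finType) (G H : sgraph T) (S : {set T}) y z :
  subrel H G -> {in S &, forall u v, G u v -> ~~ H u v -> u = y \/ v = y} ->
  co_chordal G -> co_chordal H -> y \in S -> z \in S -> z != y ->
  exists u, [/\ u \in S, u != y, simplicial (complement G) S u & simplicial (complement H) S u].
Proof.
move=> HG GH chG chH yS zS zy.
have cGH u v : complement G u v -> complement H u v.
  by case/andP=> uv nG; apply/andP; split=> //; apply: contra nG; apply: HG.
have [/existsP[w /and3P[wS wy nyw]]|/existsPn univ] :=
  boolP [exists w in S, (w != y) && ~~ complement H y w].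
  have [u [uS uy nyu simp_u]] := dirac chH yS wS wy nyw.
  exists u; split=> // a b aS bS ua ub ab.
  have /andP[_ nH] := simp_u a b aS bS (cGH _ _ ua) (cGH _ _ ub) ab.
  apply/andP; split=> //; apply/negP => Gab; case: (GH a b aS bS Gab nH) => e; subst.
    by case/negP: nyu; rewrite edge_sym; exact: cGH.
  by case/negP: nyu; rewrite edge_sym; exact: cGH.
have nHy w : w \in S -> ~~ H y w.
  move=> wS; have [->|wy] := eqVneq w y; first by rewrite edge_irr.
  by have := univ w; rewrite wS wy negbK => /andP[].
have [u [uS uy simp_u]] := exists_simplicial chG zS zy.
exists u; split=> // a b aS bS /andP[ua Hua] /andP[ub Hub] ab; apply/andP; split=> //.
have [->|ay] := eqVneq a y; first exact: nHy.
have [->|by_] := eqVneq b y; first by rewrite edge_sym nHy.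
have cG c : c \in S -> c != y -> u != c -> ~~ H u c -> complement G u c.
  move=> cS cy uc nH; apply/andP; split=> //; apply/negP => Guc.
  by case: (GH u c uS cS Guc nH) => e; move: uy cy; rewrite e eqxx.
have /andP[_] := simp_u a b aS bS (cG a aS ay ua Hua) (cG b bS by_ ub Hub) ab.
by apply: contra; apply: HG.
Qed.

(** * Edge ideals of weighted oriented graphs *)

Section WeightedOrientedGraphs.
Variables (K : fieldType) (n : nat) (D : wograph n).
Local Notation R := {mpoly K[n]}.
Implicit Types (u v x y : 'I_n) (m : 'X_{1..n}) (X : {set 'I_n}).

Definition arc_mnm x y : 'X_{1..n} := (U_(x) + U_(y) *+ weight D y)%MM.

Definition arc_gens X m :=
  exists x y, [/\ x \in X, y \in X, arc D x y & m = arc_mnm x y].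

Lemma arc_neq x y : arc D x y -> x != y.
Proof. by move=> a; apply/eqP => e; rewrite e arc_irr in a. Qed.

Lemma wo_edge_idealE : eq_ideal (wo_edge_ideal K D) (span (monomials (arc_gens setT))).
Proof.
apply: eq_span => f; split=> [[x [y [axy ->]]]|[m [x [y [_ _ axy ->]]] ->]].
  exists (arc_mnm x y); first by exists x, y; rewrite !inE.
  by rewrite mpolyXD mpolyXn.
by exists x, y; rewrite mpolyXD mpolyXn.
Qed.

Lemma mnm_edge_le u v x y k k' : u != v -> (0 < k)%N ->
  (U_(u) + U_(v) *+ k <= U_(x) + U_(y) *+ k')%MM ->
  (u = x /\ v = y) \/ (u = y /\ v = x).
Proof.
move=> uv k0 /mnm_lepP le.
have ou : u = x \/ u = y.
  have := le u; rewrite !mnmDE !mulmnE !mnm1E eqxx.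
  by case: (x =P u) => [->|_]; [left | case: (y =P u) => [->|_]; [right | lia]].
have ov : v = x \/ v = y.
  have := le v; rewrite !mnmDE !mulmnE !mnm1E eqxx.
  by case: (x =P v) => [->|_]; [left | case: (y =P v) => [->|_]; [right | lia]].
by case: ou ov uv => -> [] ->; rewrite ?eqxx //; auto.
Qed.

Lemma arc_gens_antichain X : antichain (arc_gens X).
Proof.
move=> _ _ [u [v [_ _ auv ->]]] [x [y [_ _ axy ->]]].
case/(mnm_edge_le (arc_neq auv) (weight_gt0 D v)) => -[uE vE]; subst => //.
by move: (arc_asym auv); rewrite axy.
Qed.

Lemma addmAC (m1 m2 m3 : 'X_{1..n}) : (m1 + m2 + m3 = m1 + m3 + m2)%MM.
Proof. by rewrite -!addmA [(m2 + _)%MM]addmC. Qed.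

Lemma multiple_arc_edge x y : x != y ->
  multiple (arc_gens setT) (U_(x) + U_(y) *+ 1)%MM ->
  arc D x y && (weight D y == 1%N) || arc D y x && (weight D x == 1%N).
Proof.
move=> xy [_ [u [v [_ _ auv ->]]] le].
have w1 : weight D v == 1%N.
  rewrite eqn_leq weight_gt0 andbT; move/mnm_lepP/(_ v): le.
  rewrite !mnmDE !mulmnE !mnm1E eqxx; move: xy.
  by case: (x =P v) => [->|_]; case: (y =P v) => [->|_]; rewrite ?eqxx //; lia.
by case: (mnm_edge_le (arc_neq auv) (weight_gt0 D v) le) => -[<- <-]; rewrite auv w1 ?orbT.
Qed.

Lemma underlyingE u v : underlying D u v = arc D u v || arc D v u.
Proof. by []. Qed.

Section Degree2.
Variable H : sgraph 'I_n.
Hypothesis degH : degree2_graph K D H.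

Lemma degree2_graphE x y :
  H x y = arc D x y && (weight D y == 1%N) || arc D y x && (weight D x == 1%N).
Proof.
pose edges m := exists u v, H u v /\ m = (U_(u) + U_(v) *+ 1)%MM.
have HE : eq_ideal (edge_ideal K H) (span (monomials edges)).
  apply: eq_span => f; split=> [[u [v [Huv ->]]]|[m [u [v [Huv ->]]] ->]].
    by exists (U_(u) + U_(v) *+ 1)%MM; [exists u, v | rewrite mulm1n mpolyXD].
  by exists u, v; rewrite mulm1n mpolyXD.
have H_neq u v : H u v -> u != v.
  by move=> Huv; apply/eqP => e; rewrite e edge_irr in Huv.
have [_ deg2] := degH.
have key u v : multiple edges (U_(u) + U_(v) *+ 1)%MM <->
    mdeg (U_(u) + U_(v) *+ 1)%MM = 2 /\ multiple (arc_gens setT) (U_(u) + U_(v) *+ 1)%MM.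
  rewrite -(mem_spanX K) -(HE _) (deg2 _) (degree_component_monomials 2 wo_edge_idealE _).
  rewrite mem_spanX; split=> [[m [dm Mm] le]|[dm Mm]]; last by exists (U_(u) + U_(v) *+ 1)%MM => //; exact: lepm_refl.
  by split; [rewrite mulm1n mdegD !mdeg1 | exact: multiple_le Mm le].
apply/idP/idP => [Hxy|].
  have /key[_] : multiple edges (U_(x) + U_(y) *+ 1)%MM.
    by apply: multiple_gen; exists x, y.
  exact/multiple_arc_edge/H_neq.
suff aH u v : arc D u v && (weight D v == 1%N) -> H u v.
  by case/orP=> /aH //; rewrite edge_sym.
case/andP=> auv /eqP wv.
have /key[_ [a [b [Hab ->]]]] : mdeg (U_(u) + U_(v) *+ 1)%MM = 2 /\
    multiple (arc_gens setT) (U_(u) + U_(v) *+ 1)%MM.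
  split; first by rewrite mulm1n mdegD !mdeg1.
  by apply: multiple_gen; exists u, v; rewrite /arc_mnm wv !inE.
by case/(mnm_edge_le (H_neq _ _ Hab) (ltnSn 0)) => -[<- <-] //; rewrite edge_sym.
Qed.

Hypothesis one_weight : {in nontrivial_weights D &, forall u v, u = v}.

Lemma weight1 x y : (1 < weight D y)%N -> x != y -> weight D x = 1%N.
Proof.
move=> wy xy; apply/eqP; rewrite eqn_leq weight_gt0 andbT leqNgt.
by apply: contra xy => wx; apply/eqP; apply: one_weight; rewrite inE.
Qed.

Lemma subrel_H : subrel H (underlying D).
Proof. by case: degH. Qed.

Lemma underlying_not_H u v : underlying D u v -> ~~ H u v ->
  (1 < weight D u)%N \/ (1 < weight D v)%N.
Proof.
rewrite degree2_graphE /= negb_or => /orP[a|a]; rewrite a /= => /andP[n1 n2].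
  by right; have := weight_gt0 D v; lia.
by left; have := weight_gt0 D u; lia.
Qed.

(** ** Co-chordality gives a vertex splitting *)

(** The power of [x_u] that completes [x] to a generator, for [x] of weight 1 and [u]
    adjacent to [x]. *)
Definition star_exp x u := if arc D x u then weight D u else 1%N.

Lemma star_exp_le x u : (star_exp x u <= weight D u)%N.
Proof. by rewrite /star_exp; case: ifP => // _; exact: weight_gt0. Qed.

(** All vertices of [X] but one have weight 1, and one of these, [x], is simplicial in
    both complements. A generator that avoids [x] has an endpoint [t] adjacent to
    [x]; the adjacency in [H], available when the generator is an edge of [H],
    guarantees that [x_t] itself, and not only a higher power, completes [x]. *)
Lemma vertex_splittable_arcs X :
  co_chordal (underlying D) -> co_chordal H ->
  vertex_splittable_in X (span_in X (monomials (arc_gens X)) : R -> Prop).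
Proof.
move=> chG chH; move kX: #|X| => k; elim: k X kX => [|k IH] X kX.
  by apply: vertex_splittable_empty => m [x [y [xX]]]; rewrite (cards0_eq kX) inE in xX.
have [y [yX wX]] : exists y, y \in X /\ {in X, forall u, 1 < weight D u -> u = y}%N.
  have [/existsP[y /andP[yX wy]]|/existsPn w1] := boolP [exists y in X, (1 < weight D y)%N].
    by exists y; split=> // u uX wu; apply: one_weight; rewrite inE.
  have [y yX] : exists y, y \in X by apply/card_gt0P; rewrite kX.
  by exists y; split=> // u uX wu; have := w1 u; rewrite uX wu.
have [/existsP[z /andP[zX zy]]|/existsPn only_y] := boolP [exists z in X, z != y]; last first.
  apply: vertex_splittable_empty => m [u [v [uX vX auv _]]].
  have := only_y u; have := only_y v; rewrite uX vX /= !negbK => /eqP vy /eqP uy.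
  by move: (arc_neq auv); rewrite uy vy eqxx.
have GH : {in X &, forall u v, underlying D u v -> ~~ H u v -> u = y \/ v = y}.
  by move=> u v uX vX Guv nH; case: (underlying_not_H Guv nH) => /wX; auto.
have [x [xX xy simpG simpH]] := common_simplicial subrel_H GH chG chH yX zX zy.
have wx : weight D x = 1%N.
  apply/eqP; rewrite eqn_leq weight_gt0 andbT leqNgt; apply/negP => /(wX _ xX) xyE.
  by rewrite xyE eqxx in xy.
pose U := [set u in X :\ x | underlying D x u].
have UP u : reflect [/\ u != x, u \in X & underlying D x u] (u \in U).
  by rewrite !inE; apply: (iffP andP) => [[/andP[]]|[-> ->]].
have w1 u v : u \in X -> v \in X -> (1 < weight D v)%N -> u != v -> weight D u = 1%N.
  by move=> uX vX wv uv; apply: weight1 wv uv.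
apply: (@vertex_splittable_split _ _ X x (pure_powers U (star_exp x)) (arc_gens (X :\ x))) => //.
- by move=> _ [u /UP[ux uX _] ->]; apply: mnm_inMn; rewrite mnm_in1 !inE ux.
- by move=> _ [u [v [uX vX _ ->]]]; rewrite mnm_inD mnm_in1 uX /=; apply: mnm_inMn; rewrite mnm_in1.
- apply: vertex_splittable_pure_powers.
  + by apply/subsetP => u /UP[ux uX _]; rewrite !inE ux.
  + by move=> u; rewrite /star_exp; case: ifP => // _; exact: weight_gt0.
  + move=> u v /UP[_ uX _] /UP[_ vX _] eu ev.
    by rewrite (wX u uX (leq_trans eu (star_exp_le x u))) (wX v vX (leq_trans ev (star_exp_le x v))).
- by apply: IH; move: kX; rewrite (cardsD1 x) xX => -[].
- move=> _ [u [v [/setD1P[ux uX] /setD1P[vx vX] auv ->]]].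
  have uv := arc_neq auv.
  have le1 : (U_(u) <= arc_mnm u v)%MM by exact: lepm_addr.
  have le2 : (U_(v) *+ weight D v <= arc_mnm u v)%MM by rewrite /arc_mnm addmC lepm_addr.
  have star t j : t \in U -> (star_exp x t <= j)%N -> (U_(t) *+ j <= arc_mnm u v)%MM ->
      multiple (pure_powers U (star_exp x)) (arc_mnm u v).
    move=> tU tk le; exists (U_(t) *+ star_exp x t)%MM; first by exists t.
    apply: lepm_trans le; apply/mnm_lepP => i; rewrite !mulmnE leq_mul2l tk.
    exact: orbT.
  have nadj (B : sgraph 'I_n) t : ~~ B x t -> t != x -> complement B x t.
    by move=> nB tx; apply/andP; rewrite eq_sym.
  have GU t : t \in X -> t != x -> underlying D x t -> t \in U by move=> *; apply/UP.
  have [wv1|wv] := eqVneq (weight D v) 1%N.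
    (* an edge of [H]: one endpoint [t] is adjacent to [x] in [H] *)
    have Huv : H u v by rewrite degree2_graphE auv wv1.
    have starH t : t \in X -> t != x -> H x t -> star_exp x t = 1%N.
      rewrite degree2_graphE /star_exp => _ _ /orP[/andP[-> /eqP->]//|/andP[a _]].
      by rewrite (negbTE (arc_asym a)).
    have [Hxu|nu] := boolP (H x u).
      by apply: (star u 1%N); [exact/GU/subrel_H | rewrite starH | rewrite mulm1n].
    have [Hxv|nv] := boolP (H x v).
      by apply: (star v (weight D v)); [exact/GU/subrel_H | rewrite starH // weight_gt0 |].
    by have /andP[_] := simpH u v uX vX (nadj H u nu ux) (nadj H v nv vx) uv; rewrite Huv.
  have {}wv : (1 < weight D v)%N by rewrite ltn_neqAle eq_sym wv weight_gt0.
  have wu : weight D u = 1%N by exact: w1 wv uv.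
  have Guv : underlying D u v by rewrite underlyingE auv.
  have [Gxu|nu] := boolP (underlying D x u).
    by apply: (star u 1%N); [exact: GU | rewrite -wu star_exp_le | rewrite mulm1n].
  have [Gxv|nv] := boolP (underlying D x v).
    by apply: (star v (weight D v)); [exact: GU | exact: star_exp_le |].
  have /andP[_] := simpG u v uX vX (nadj _ u nu ux) (nadj _ v nv vx) uv.
  by rewrite Guv.
- move=> m; split.
    case=> u [v [uX vX auv ->]]; have uv := arc_neq auv.
    have [ux|ux] := eqVneq u x.
      left; exists (U_(v) *+ weight D v)%MM; last by rewrite ux.
      exists v; last by rewrite /star_exp -ux auv.
      by apply/UP; rewrite -ux; split; rewrite // ?[v == u]eq_sym // underlyingE auv.
    have [vx|vx] := eqVneq v x.
      left; exists U_(u)%MM; last by rewrite /arc_mnm vx wx mulm1n addmC.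
      exists u; first by apply/UP; rewrite -vx; split=> //; rewrite underlyingE auv orbT.
      by rewrite /star_exp -vx (negbTE (arc_asym auv)) mulm1n.
    by right; exists u, v; rewrite !inE ux vx.
  case=> [[_ [u /UP[ux uX Gxu] ->] ->]|[u [v [/setD1P[_ uX] /setD1P[_ vX] auv ->]]]]; last by exists u, v.
  rewrite /star_exp; case: ifP => [axu|nxu]; first by exists x, u.
  exists u, x; split=> //; last by rewrite /arc_mnm wx !mulm1n addmC.
  by move: Gxu; rewrite underlyingE nxu.
exact: arc_gens_antichain.
Qed.

(** ** Linear components give co-chordality *)

Definition degree_gens d m := mdeg m = d /\ multiple (arc_gens setT) m.

(** Enough degree in [m] leaves room for a multiple of the generator in degree
    exactly [d]. *)
Lemma multiple_degree_gens d x y m : arc D x y -> (arc_mnm x y <= m)%MM ->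
  (weight D y < d)%N -> (d <= mdeg m)%N -> multiple (degree_gens d) m.
Proof.
move=> axy le wd dm.
have [|m' /andP[xym' m'm] dm'] := lepm_between (d := d) le.
  by rewrite dm andbT /arc_mnm mdegD mdegMn !mdeg1 mul1n add1n.
exists m' => //; split=> //; exists (arc_mnm x y) => //.
by exists x, y; rewrite !inE.
Qed.

Lemma edge_componentE d :
  eq_ideal (degree_component d (wo_edge_ideal K D)) (span (monomials (degree_gens d))).
Proof. exact: degree_component_monomials wo_edge_idealE. Qed.

Lemma componentwise_linear_H :
  componentwise_linear (wo_edge_ideal K D) -> co_chordal H.
Proof.
move=> lin c cc; rewrite leqNgt; apply/negP => c3.
have [uc c2 Bc] := cc.
have Hn v : v \in c -> ~~ H v (next c v) /\ v != next c v.
  move=> vc; have : complement H v (next c v) by rewrite Bc ?mem_next // eqxx.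
  by case/andP.
apply: (cycle_obstruction (g := 0%MM) (edge_componentE 2) uc c2 _ _ _ _ (lin 2)).
- by rewrite mdeg0.
- by move=> v; rewrite mnm0E.
- move=> v /Hn[nH vn]; rewrite add0m => -[m [_ Mm] le]; case/negP: nH.
  rewrite degree2_graphE; apply: multiple_arc_edge => //.
  by rewrite mulm1n; exact: multiple_le le.
move=> u v w uc' vc wc uvw; rewrite add0m.
have edge a b m : H a b -> (U_(a) + U_(b) <= m)%MM -> (2 <= mdeg m)%N ->
    multiple (degree_gens 2) m.
  rewrite degree2_graphE => /orP[/andP[ar w1]|/andP[ar w1]] le dm.
    by apply: (multiple_degree_gens ar) => //; rewrite /arc_mnm (eqP w1) ?mulm1n.
  by apply: (multiple_degree_gens ar) => //; rewrite /arc_mnm (eqP w1) // mulm1n addmC.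
have dm : (2 <= mdeg (U_(u) + U_(v) + U_(w)))%N by rewrite !mdegD !mdeg1.
move: (uvw); rewrite /= !inE => /andP[/norP[uv uw] /andP[vw _]].
have /or3P[] := induced_cycle_triangle_free cc c3 uc' vc wc uvw.
- rewrite negb_and uv negbK => Hab; apply: edge Hab _ dm; exact: lepm_addr.
- rewrite negb_and uw negbK => Hab; apply: edge Hab _ dm.
  by rewrite -addmA [(U_(v) + _)%MM]addmC addmA lepm_addr.
- rewrite negb_and vw negbK => Hab; apply: edge Hab _ dm.
  by rewrite -addmA [(U_(u) + _)%MM]addmC lepm_addr.
Qed.

(** Only cycles through the vertex [y] of large weight remain. The cycle obstruction is
    applied in degree [weight D y + 1], with [y ^ (weight D y - 1)] as the extra
    factor: that monomial times two consecutive vertices of the cycle could only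
    lie in the ideal through an edge of [H] at [y]. *)
Lemma componentwise_linear_G :
  componentwise_linear (wo_edge_ideal K D) -> co_chordal (underlying D).
Proof.
move=> lin; have chH := componentwise_linear_H lin.
move=> c cc; rewrite leqNgt; apply/negP => c3.
have GH u v : weight D u = 1%N -> weight D v = 1%N ->
    complement (underlying D) u v = complement H u v.
  move=> wu wv; congr (_ && ~~ _).
  by rewrite underlyingE degree2_graphE wu wv !eqxx !andbT.
have [/hasP[y yc wy]|/hasPn w1] := boolP (has (fun y => 1 < weight D y)%N c); last first.
  have {}w1 v : v \in c -> weight D v = 1%N.
    by move=> /w1; rewrite -leqNgt => w1'; apply/eqP; rewrite eqn_leq w1' weight_gt0.
  have /chH : induced_cycle (complement H) c.
    by case: cc => uc c2 Bc; split=> // u v uc' vc; rewrite -GH ?w1 // Bc.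
  by rewrite leqNgt c3.
have [k r cE] := rot_to yc.
have {}cc : induced_cycle (complement (underlying D)) (y :: r).
  by rewrite -cE; exact: induced_cycle_rot.
have {}c3 : (3 < size (y :: r))%N by rewrite -cE size_rot.
clear c cE yc k.
have [uc c2 Bc] := cc.
have yr : y \notin r by case/andP: uc.
have w1 v : v != y -> weight D v = 1%N by move=> vy; apply: weight1 wy vy.
have subGH u v : complement (underlying D) u v -> complement H u v.
  by case/andP=> uv nG; apply/andP; split=> //; apply: contra nG; exact: subrel_H.
have r0 : (0 < size r)%N by move: c3; rewrite /= ltnS; apply: leq_trans.
have Bnth i j := induced_cycleP y cc (i := i) (j := j).
have wr i : (i < size r)%N -> weight D (nth y r i) = 1%N.
  by move=> ir; apply: w1; apply: contraNneq yr => <-; exact: mem_nth.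
(* a neighbour of [y] in [H] on the cycle would leave an induced cycle for [H] *)
have nHy v : v \in r -> ~~ H y v.
  move=> vr; apply/negP => Hyv.
  have vE : nth y r (index v r) = v by exact: nth_index.
  apply: (@cycle_shortcut _ (complement H) y r (index v r) uc _ _ _ _ _ chH).
  - move=> i j ijr; have /andP[ij jr] := ijr.
    rewrite -GH ?wr ?(ltn_trans ij jr) //.
    have /= -> := Bnth i.+1 j.+1; last by rewrite /= !ltnS.
    by rewrite /cycle_adj orbF eqSS.
  - by apply: subGH; have /= -> := Bnth 0%N 1%N; rewrite //= ltnS.
  - apply: subGH; have /= := Bnth 0%N (size r); rewrite r0 ltnS leqnn => /(_ isT).
    rewrite /cycle_adj /= eqxx orbT; by case: (r) r0.
  - by rewrite index_mem.
  - by rewrite vE; apply/negP => /andP[_]; rewrite Hyv.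
pose g := (U_(y) *+ (weight D y).-1)%MM : 'X_{1..n}.
have dg : (mdeg g + 2)%N = (weight D y).+1 by rewrite mdegMn mdeg1; lia.
have gE v : g v = (if v == y then (weight D y).-1 else 0)%N.
  by rewrite mulmnE mnm1E eq_sym; case: eqP; lia.
apply: (cycle_obstruction (edge_componentE (weight D y).+1) uc c2 dg _ _ _ (lin _)).
- by move=> v; rewrite gE; case: eqP => // ->; rewrite mem_head.
- move=> v vc [m [_ [_ [a [b [_ _ ab ->]]] le']] le].
  have /andP[vn nG] : complement (underlying D) v (next (y :: r) v).
    by rewrite Bc ?mem_next // eqxx.
  have v'c : next (y :: r) v \in y :: r by rewrite mem_next.
  move: (next _ v) v'c vn nG le => v' v'c vn nG le.
  have {}le := lepm_trans le' le.
  have nab := arc_neq ab.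
  have av : a = y \/ a = v \/ a = v'.
    have [|ay] := eqVneq a y; [by left | right].
    have := mnm_lepP le a; rewrite !mnmDE !mnm1E eqxx gE (negbTE ay) add0n.
    by case: (v =P a) => [->|_]; [left | case: (v' =P a) => [->|]; [right|]].
  have bv : b = v \/ b = v'.
    have := mnm_lepP le b; rewrite !mnmDE mulmnE !mnm1E eqxx mul1n gE.
    case: (v =P b) => [->|_]; first by left.
    case: (v' =P b) => [->|_]; first by right.
    move: (weight_gt0 D y) (weight_gt0 D b).
    by case: (b =P y) => [->|_]; clear; lia.
  have adj : (a = v \/ a = v') -> False.
    case: bv => bE [] aE; move: ab nab; rewrite aE bE ?eqxx // => ab _; case/negP: nG.
      by rewrite underlyingE ab orbT.
    by rewrite underlyingE ab.
  case: av => [ay|]; last exact: adj.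
  have by_ : b != y by rewrite -ay eq_sym.
  have br : b \in r.
    have : b \in y :: r by case: bv => ->.
    by rewrite inE (negbTE by_).
  by case/negP: (nHy b br); rewrite degree2_graphE -ay ab w1.
have wle v : (weight D v <= weight D y)%N.
  by have [->//|/w1->] := eqVneq v y; exact: weight_gt0.
have arc_le a b : (arc_mnm a b <= g + U_(a) + U_(b))%MM.
  apply/mnm_lepP => i; rewrite !mnmDE mulmnE !mnm1E gE.
  have [ib|] := eqVneq b i; last by lia.
  rewrite -ib; case: (b =P y) => [->|/eqP/w1->]; last by lia.
  by move: (weight_gt0 D y); clear; lia.
have edge a b m : underlying D a b -> (g + U_(a) + U_(b) <= m)%MM ->
    (weight D y < mdeg m)%N -> multiple (degree_gens (weight D y).+1) m.
  rewrite underlyingE => /orP[] ar le dm; apply: (multiple_degree_gens ar); rewrite ?ltnS ?wle //.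
    by apply: lepm_trans le; exact: arc_le.
  by apply: lepm_trans le; rewrite addmAC; exact: arc_le.
move=> u v w uc' vc wc uvw.
have dm : (weight D y < mdeg (g + U_(u) + U_(v) + U_(w)))%N.
  by rewrite !mdegD !mdeg1 addn1 -addnA ltnS addnC; move: dg; rewrite addn2 => -[<-]; lia.
move: (uvw); rewrite /= !inE => /andP[/norP[uv uw] /andP[vw _]].
have /or3P[] := induced_cycle_triangle_free cc c3 uc' vc wc uvw.
- rewrite negb_and uv negbK => Gab; apply: edge Gab _ dm; exact: lepm_addr.
- rewrite negb_and uw negbK => Gab; apply: edge Gab _ dm.
  by rewrite [(g + U_(u) + U_(v) + _)%MM]addmAC lepm_addr.
- rewrite negb_and vw negbK => Gab; apply: edge Gab _ dm.
  by rewrite [(g + U_(u) + U_(v))%MM]addmAC [(_ + U_(u) + U_(w))%MM]addmAC lepm_addr.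
Qed.

End Degree2.

End WeightedOrientedGraphs.

Local Close Scope ring_scope.

Theorem theorem4p4 (K : fieldType) (n : nat) (D : wograph n)
    (H : sgraph 'I_n) :
  #|nontrivial_weights D| <= 1 ->
  degree2_graph K D H ->
  [<-> componentwise_linear (wo_edge_ideal K D);
       vertex_splittable (wo_edge_ideal K D);
       linear_quotients (wo_edge_ideal K D);
       co_chordal (underlying D) /\ co_chordal H].
Proof.
move=> /card_le1_eqP card1 degH.
have one_weight : {in nontrivial_weights D &, forall u v, u = v} by move=> u v uA vA; exact: card1 vA uA.
have co_chordal_of_linear : componentwise_linear (wo_edge_ideal K D) ->
    co_chordal (underlying D) /\ co_chordal H.
  move=> lin; split; first exact: componentwise_linear_G degH one_weight lin.
  exact: componentwise_linear_H degH lin.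
tfae.
- case/co_chordal_of_linear => chG chH.
  apply: (vertex_splittable_eq (@wo_edge_idealE K n D)).
  exact: vertex_splittable_arcs degH one_weight _ chG chH.
- exact: vertex_splittable_linear_quotients.
- by move/linear_quotients_componentwise.
case=> chG chH; apply: linear_quotients_componentwise.
apply: vertex_splittable_linear_quotients.
apply: (vertex_splittable_eq (@wo_edge_idealE K n D)).
exact: vertex_splittable_arcs degH one_weight _ chG chH.
Qed.
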